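(* Let $(\mathfrak{M},g)$ be a compact, orientable, connected, smooth Riemannian manifold whose boundary is either empty or smooth, with $d=\dim\mathfrak{M}<\min\{4,D\}$, and let $\mathbb{P}$ be a Borel probability measure on $\mathbb{R}^D$ with compact support. Let $\lambda>0$ and let $\boldsymbol{X}_1,\boldsymbol{X}_2,\dots$ be i.i.d. with distribution $\mathbb{P}$. Suppose the global minimizer $\boldsymbol{f}^*_\lambda$ of $\mathcal{L}_\lambda$ over $\mathscr{F}(\mathbb{P})$ is locally unique in the sense that $$\mathcal{L}_\lambda(\boldsymbol{f}^*_\lambda)<\inf_{\boldsymbol{f}\in\mathscr{F}(\mathbb{P})\setminus\mathscr{G}}\mathcal{L}_\lambda(\boldsymbol{f})$$ for every subset $\mathscr{G}\subseteq C(\mathfrak{M};\mathbb{R}^D)$ that is open in the supremum norm topology and contains $\boldsymbol{f}^*_\lambda$. For each $N$, let $\boldsymbol{f}^*_{N,\lambda}$ be a minimizer of $\mathcal{L}_{N,\lambda}$ over $\mathscr{F}(\mathbb{P}_N)$. Then $\|\boldsymbol{f}^*_{N,\lambda}-\boldsymbol{f}^*_\lambda\|_{C(\mathfrak{M})}$ converges to zero in outer probability as $N\to\infty$.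
   Context: $\nabla$ is the Levi-Civita connection of $g$, and for scalar $f$ the Hessian is the symmetric $(0,2)$-tensor $\nabla^2 f(u,v)=u(vf)-(\nabla_u v)f$. For $\boldsymbol{f}=(f_1,\dots,f_D):\mathfrak{M}\to\mathbb{R}^D$, $\|\boldsymbol{f}\|_{L^2(\mathfrak{M})}^2=\sum_j\int_{\mathfrak{M}}|f_j|^2\,d\mathrm{vol}_g$ and $\|\nabla^2\boldsymbol{f}\|_{L^2(\mathfrak{M})}^2=\sum_{j=1}^D\int_{\mathfrak{M}}|\nabla^2 f_j|_g^2\,d\mathrm{vol}_g$, where $|T|_g^2=\sum_{i,k}T(e_i,e_k)^2$ for any $g$-orthonormal basis $\{e_i\}$ of the tangent space. $H^2(\mathfrak{M};\mathbb{R}^D)$ is the completion of $C^\infty(\mathfrak{M};\mathbb{R}^D)$ in the norm $\|\boldsymbol{f}\|_{H^2(\mathfrak{M})}=(\|\boldsymbol{f}\|_{L^2(\mathfrak{M})}^2+\|\nabla^2\boldsymbol{f}\|_{L^2(\mathfrak{M})}^2)^{1/2}$ (Hessians understood weakly). Since $d<4$, $H^2(\mathfrak{M};\mathbb{R}^D)\subseteq C(\mathfrak{M};\mathbb{R}^D)$, and elements are identified with their continuous representatives. A projection index of a continuous $\boldsymbol{f}:\mathfrak{M}\to\mathbb{R}^D$ is any Borel measurable map $\boldsymbol{\pi}_{\boldsymbol{f}}:\mathbb{R}^D\to\mathfrak{M}$ with $\|\boldsymbol{x}-\boldsymbol{f}(\boldsymbol{\pi}_{\boldsymbol{f}}(\boldsymbol{x}))\|=\min_{\boldsymbol{m}\in\mathfrak{M}}\|\boldsymbol{x}-\boldsymbol{f}(\boldsymbol{m})\|$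 for all $\boldsymbol{x}$. For a compactly supported probability measure $\mathbb{Q}$ on $\mathbb{R}^D$, $\mathrm{rad}_0(\mathrm{supp}(\mathbb{Q}))=\sup_{\boldsymbol{x}\in\mathrm{supp}(\mathbb{Q})}\|\boldsymbol{x}\|$ and $$\mathscr{F}(\mathbb{Q})=\Big\{\boldsymbol{f}\in H^2(\mathfrak{M};\mathbb{R}^D):\max_{\boldsymbol{m}\in\mathfrak{M}}\|\boldsymbol{f}(\boldsymbol{m})\|\le 2\,\mathrm{rad}_0(\mathrm{supp}(\mathbb{Q}))\Big\}.$$ $\mathbb{P}_N=\frac1N\sum_{i=1}^N\delta_{\boldsymbol{X}_i}$. With $\boldsymbol{X}\sim\mathbb{P}$, $$\mathcal{L}_\lambda(\boldsymbol{f})=\mathbb{E}\{\|\boldsymbol{X}-\boldsymbol{f}(\boldsymbol{\pi}_{\boldsymbol{f}}(\boldsymbol{X}))\|^2\}+\lambda\|\nabla^2\boldsymbol{f}\|_{L^2(\mathfrak{M})}^2,\qquad \mathcal{L}_{N,\lambda}(\boldsymbol{f})=\frac1N\sum_{i=1}^N\|\boldsymbol{X}_i-\boldsymbol{f}(\boldsymbol{\pi}_{\boldsymbol{f}}(\boldsymbol{X}_i))\|^2+\lambda\|\nabla^2\boldsymbol{f}\|_{L^2(\mathfrak{M})}^2.$$ A sequence of (possibly non-measurable) real functions $Z_N$ on the underlying probability space converges to $0$ in outer probability if for every $\varepsilon>0$ the outer probability of $\{|Z_N|>\varepsilon\}$ tends to $0$. $\|\boldsymbol{f}\|_{C(\mathfrak{M})}=\max_{\boldsymbol{m}}\|\boldsymbol{f}(\boldsymbol{m})\|$.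 *)

(* Defs.v *)
From HB Require Import structures.
From mathcomp Require Import all_boot all_order all_algebra finmap.
From mathcomp Require Import all_classical all_reals all_analysis.
From mathcomp Require Import ring.

Set Implicit Arguments.
Unset Strict Implicit.
Unset Printing Implicit Defensive.

Import Order.TTheory GRing.Theory Num.Theory.
Import numFieldNormedType.Exports.

Local Open Scope classical_set_scope.
Local Open Scope ring_scope.

(* Borel sigma-algebra of a topological space, and the Euclidean norm (the
   library norm on row vectors is the sup norm, which has the same topology). *)

Notation borel T := (g_sigma_algebraType (@open T)).

Definition enorm (R : realType) (n : nat) (x : 'rV[R]_n) : R :=
  Num.sqrt (\sum_(i < n) x ord0 i ^+ 2).

(* Lebesgue integral over R^n of a nonnegative Borel function, as an iterated
   integral (Tonelli). *)
Fixpoint lebesgue_rV (R : realType) (n : nat) : ('rV[R]_n -> \bar R) -> \bar R :=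
  match n with
  | 0 => fun f => f 0
  | n'.+1 => fun f =>
      (\int[@lebesgue_measure R]_x
         lebesgue_rV (fun v : 'rV[R]_n' => f (row_mx (x%:M : 'rV[R]_1) v)))%E
  end.

(* The model space is {x | x_0 >= 0}, which is a single point for n = 0. *)
Definition half_space (R : realType) (n : nat) : set 'rV[R]_n :=
  [set x | forall i : 'I_n, nat_of_ord i = 0%N -> 0 <= x ord0 i].
Arguments half_space {R} n.

(* Partial derivative along A: at a boundary point of a relatively open subset
   A of the half-space, the derivative across the boundary is one-sided. *)
Definition pderiv (R : realType) (n : nat) (A : set 'rV[R]_n) (i : 'I_n)
    (f : 'rV[R]_n -> R) (x : 'rV[R]_n) : R :=
  lim ((fun h : R => h^-1 * (f (x + h *: delta_mx ord0 i) - f x)) @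
         within [set h | A (x + h *: delta_mx ord0 i)] 0^').

Fixpoint Ck_open (R : realType) (n k : nat) (U : set 'rV[R]_n)
    (f : 'rV[R]_n -> R) : Prop :=
  (forall x, U x -> {for x, continuous f}) /\
  match k with
  | 0 => True
  | k'.+1 => forall i : 'I_n,
      (forall x, U x -> derivable f x (delta_mx ord0 i)) /\
      Ck_open k' U (fun x => 'D_(delta_mx ord0 i) f x)
  end.

(* Smoothness on a set that need not be open: local smooth extensions exist. *)
Definition smooth_on (R : realType) (n : nat) (A : set 'rV[R]_n)
    (f : 'rV[R]_n -> R) : Prop :=
  forall x, A x -> exists (U : set 'rV[R]_n) (F : 'rV[R]_n -> R),
    [/\ open U, U x, forall k, Ck_open k U F &
        forall y, A y -> U y -> F y = f y].

(* Smooth d-manifold with possibly empty boundary, given by an atlas of charts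
   onto relatively open subsets of the half-space. [param] is the inverse of
   the coordinate map; [chart_at] picks a chart around each point. *)
Record smoothManifold (R : realType) (d : nat) := SmoothManifold {
  carrier :> ptopologicalType ;
  carrier_hausdorff : hausdorff_space carrier ;
  carrier_second_countable : @second_countable carrier ;
  chart : Type ;
  dom : chart -> set carrier ;
  coord : chart -> carrier -> 'rV[R]_d ;
  param : chart -> 'rV[R]_d -> carrier ;
  chart_at : carrier -> chart ;
  chart_atP : forall p, dom (chart_at p) p ;
  dom_open : forall c, open (dom c) ;
  coord_open : forall c, exists2 W : set 'rV[R]_d, open W &
    coord c @` dom c = W `&` half_space d ;
  coordK : forall c p, dom c p -> param c (coord c p) = p ;
  coord_continuous : forall c, {within dom c, continuous (coord c)} ;
  param_continuous : forall c,
    {within coord c @` dom c, continuous (param c)} ;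
  transition_smooth : forall c c' (i : 'I_d),
    smooth_on (coord c @` (dom c `&` dom c'))
      (fun x => coord c' (param c x) ord0 i)
}.

Arguments dom {R d s}.
Arguments coord {R d s}.
Arguments param {R d s}.
Arguments chart_at {R d s}.

Definition codom (R : realType) (d : nat) (M : smoothManifold R d)
  (c : chart M) : set 'rV[R]_d := coord c @` dom c.

(* Entry (i, j) is the i-th partial derivative of the j-th new coordinate. *)
Definition jacobian_mx (R : realType) (d : nat) (M : smoothManifold R d)
    (c c' : chart M) (x : 'rV[R]_d) : 'M[R]_d :=
  \matrix_(i, j) pderiv (coord c @` (dom c `&` dom c')) i
    (fun y => coord c' (param c y) ord0 j) x.

(* An orientation is a locally constant choice of an orientation of every
   tangent space; [o c p] tells that the coordinate frame of c at p is
   negatively oriented. Unlike "there is an atlas with positive Jacobians",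
   this is also right for 1-manifolds with boundary modelled on [0, +oo[. *)
Definition orientable (R : realType) (d : nat) (M : smoothManifold R d) : Prop :=
  exists o : chart M -> M -> bool,
    (forall c p, dom c p -> \forall q \near p, o c q = o c p) /\
    (forall c c' p, dom c p -> dom c' p ->
       o c p (+) o c' p = (\det (jacobian_mx c c' (coord c p)) < 0)).

(* Component matrices in every chart, with the transformation law of a
   (0,2)-tensor. *)
Record riemannianMetric (R : realType) (d : nat) (M : smoothManifold R d) :=
    RiemannianMetric {
  metric :> chart M -> 'rV[R]_d -> 'M[R]_d ;
  metric_smooth : forall c (i j : 'I_d),
    smooth_on (codom c) (fun x => metric c x i j) ;
  metric_sym : forall c x, codom c x -> (metric c x)^T = metric c x ;
  metric_pos : forall c x (v : 'rV[R]_d), codom c x -> v != 0 ->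
    0 < (v *m metric c x *m v^T) ord0 ord0 ;
  metric_change : forall c c' p, dom c p -> dom c' p ->
    metric c (coord c p) =
      jacobian_mx c c' (coord c p) *m metric c' (coord c' p) *m
      (jacobian_mx c c' (coord c p))^T
}.

(* [G k i j] is the k-th component of nabla_(d_i) d_j at x in the chart c. *)
Definition levi_civita_at (R : realType) (d : nat) (M : smoothManifold R d)
    (g : riemannianMetric M) (c : chart M) (x : 'rV[R]_d)
    (G : 'I_d -> 'I_d -> 'I_d -> R) : Prop :=
  (forall k i j, G k i j = G k j i) /\
  (forall i j k, pderiv (codom c) i (fun y => g c y j k) x =
     \sum_l G l i j * g c x l k + \sum_l G l i k * g c x j l).

(* Koszul formula; [christoffelP] identifies it with the unique torsion-free
   metric connection. *)
Definition christoffel (R : realType) (d : nat) (M : smoothManifold R d)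
    (g : riemannianMetric M) (c : chart M) (x : 'rV[R]_d) (k i j : 'I_d) : R :=
  2^-1 * \sum_l invmx (g c x) k l *
    (pderiv (codom c) i (fun y => g c y j l) x +
     pderiv (codom c) j (fun y => g c y i l) x -
     pderiv (codom c) l (fun y => g c y i j) x).

Lemma christoffelP (R : realType) (d : nat) (M : smoothManifold R d)
    (g : riemannianMetric M) (c : chart M) (x : 'rV[R]_d)
    (G : 'I_d -> 'I_d -> 'I_d -> R) : codom c x ->
  levi_civita_at g c x G <-> forall k i j, G k i j = christoffel g c x k i j.
Proof.
move=> cx; set S := g c x.
pose dg i j l := pderiv (codom c) i (fun y => g c y j l) x.
have symS j l y : codom c y -> g c y j l = g c y l j.
  by move=> cy; rewrite -[in RHS](metric_sym g cy) mxE.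
have dgC i j l : dg i j l = dg i l j.
  rewrite /dg /pderiv; congr (lim _).
  have E A : (\forall h \near within [set h : R | codom c (x + h *: delta_mx ord0 i)] 0^',
      A (h^-1 * (g c (x + h *: delta_mx ord0 i) j l - g c x j l))) =
    (\forall h \near within [set h : R | codom c (x + h *: delta_mx ord0 i)] 0^',
      A (h^-1 * (g c (x + h *: delta_mx ord0 i) l j - g c x l j))).
    apply/propext; rewrite !near_withinE; split; apply: filterS => h P h0 ch.
      by move: (P h0 ch); rewrite (symS j l _ ch) (symS j l _ cx).
    by move: (P h0 ch); rewrite (symS j l _ ch) (symS j l _ cx).
  by apply/funext => A; exact: E.
have uS : S \in unitmx.
  rewrite -row_free_unit -kermx_eq0; apply/eqP/row_matrixP => i; rewrite row0.
  apply/eqP/negPn/negP => /(metric_pos g cx); rewrite -/S.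
  by rewrite -row_mul mulmx_ker row0 mul0mx mxE ltxx.
have invS k m : \sum_l invmx S k l * S m l = (k == m)%:R.
  have /matrixP/(_ k m) := mulVmx uS; rewrite !mxE => <-.
  by apply: eq_bigr => l _; rewrite /S (symS m).
have Sinv m l : \sum_k invmx S k l * S k m = (l == m)%:R.
  have /matrixP/(_ m l) := mulmxV uS; rewrite !mxE eq_sym => <-.
  by apply: eq_bigr => k _; rewrite mulrC /S (symS k).
have chrE k i j : christoffel g c x k i j =
  2^-1 * \sum_l invmx S k l * (dg i j l + dg j i l - dg l i j) by [].
split=> [[Gs Gm] k i j|GE].
  pose b i j k := \sum_l G l i j * S l k.
  have bC i' j' k' : b i' j' k' = b j' i' k'.
    by apply: eq_bigr => l _; rewrite Gs.
  have dgE i' j' k' : dg i' j' k' = b i' j' k' + b i' k' j'.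
    rewrite /dg Gm /b; congr (_ + _); apply: eq_bigr => l _.
    by rewrite /S (symS j').
  rewrite chrE (eq_bigr (fun l => 2 * (invmx S k l * b i j l))); last first.
    move=> l _; rewrite !dgE (bC j i l) (bC j l i) (bC i l j); ring.
  rewrite -mulr_sumr mulrA mulVf ?pnatr_eq0// mul1r /b.
  under eq_bigr do rewrite mulr_sumr.
  rewrite exchange_big/=.
  under eq_bigr do (under eq_bigr do rewrite mulrCA; rewrite -mulr_sumr invS).
  rewrite (bigD1 k)//= big1 ?addr0 ?eqxx ?mulr1// => l /negbTE lk.
  by rewrite eq_sym lk mulr0.
have low i j m : \sum_k G k i j * S k m =
    2^-1 * (dg i j m + dg j i m - dg m i j).
  under eq_bigr do rewrite GE chrE -mulrA.
  rewrite -mulr_sumr; congr (_ * _).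
  under eq_bigr do rewrite mulr_suml.
  rewrite exchange_big/=.
  under eq_bigr do (under eq_bigr do rewrite mulrAC; rewrite -mulr_suml Sinv).
  rewrite (bigD1 m)//= big1 ?addr0 ?eqxx ?mul1r// => l /negbTE lm.
  by rewrite lm mul0r.
split=> [k i j|i j k].
  rewrite !GE !chrE; congr (_ * _); apply: eq_bigr => l _.
  by rewrite (dgC l i j) [dg i j l + _]addrC.
rewrite low.
rewrite (eq_bigr (fun l => G l i k * S l j)); last first.
  by move=> l _; rewrite /S (symS j).
rewrite low -/(dg i j k) (dgC i k j).
by field.
Qed.

(* Entry (i, j) is d_i (d_j f) - (nabla_(d_i) d_j) f. *)
Definition hessian (R : realType) (d : nat) (M : smoothManifold R d)
    (g : riemannianMetric M) (f : M -> R) (c : chart M) (x : 'rV[R]_d) :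
    'M[R]_d :=
  let F := fun y => f (param c y) in
  \matrix_(i, j) (pderiv (codom c) i (pderiv (codom c) j F) x -
    \sum_k christoffel g c x k i j * pderiv (codom c) k F x).

(* The rows of E are the components of a basis of the tangent space. *)
Definition orthonormal_basis (R : realType) (d : nat) (G E : 'M[R]_d) : Prop :=
  E *m G *m E^T = 1%:M.

(* Squared norm of the bilinear form T for the inner product G; by
   [tensor_norm2E] below any orthonormal basis gives the same value. *)
Definition tensor_norm2 (R : realType) (d : nat) (G T : 'M[R]_d) : R :=
  let E := get [set E : 'M[R]_d | orthonormal_basis G E] in
  \sum_i \sum_k (row i E *m T *m (row k E)^T) ord0 ord0 ^+ 2.

Definition hessian_norm2 (R : realType) (d : nat) (M : smoothManifold R d)
    (g : riemannianMetric M) (f : M -> R) (p : M) : R :=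
  let c := chart_at p in
  tensor_norm2 (g c (coord c p)) (hessian g f c (coord c p)).

Lemma tensor_norm2E (R : realType) (d : nat) (G T E : 'M[R]_d) :
  orthonormal_basis G E ->
  tensor_norm2 G T =
  \sum_i \sum_k (row i E *m T *m (row k E)^T) ord0 ord0 ^+ 2.
Proof.
suff tr E' : orthonormal_basis G E' ->
    \sum_i \sum_k (row i E' *m T *m (row k E')^T) ord0 ord0 ^+ 2 =
    \tr (invmx G *m T *m (invmx G *m T^T)).
  move=> EG; rewrite (tr E)// /tensor_norm2 tr//.
  by apply: (getPex (P := [set E : 'M[R]_d | orthonormal_basis G E])); exists E.
rewrite /orthonormal_basis => EG.
have GE : invmx G = E'^T *m E'.
  have := EG => /mulmx1C; rewrite mulmxA => H.
  have [_ uG] := mulmx1_unit H.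
  by rewrite -[RHS]mulmx1 -(mulmxV uG) (mulmxA _ G) H mul1mx.
pose B := E' *m T *m E'^T.
transitivity (\tr (B *m B^T)).
  rewrite /mxtrace; apply: eq_bigr => i _; rewrite mxE; apply: eq_bigr => k _.
  rewrite [B^T _ _]mxE -expr2; congr (_ ^+ 2).
  by rewrite /B -!row_mul tr_row !mxE; apply: eq_bigr => j _; rewrite !mxE.
by rewrite GE /B !trmx_mul trmxK -![in RHS]mulmxA [RHS]mxtrace_mulC !mulmxA.
Qed.

(* These conditions determine vol, since countably many chart domains cover
   the manifold. *)
Definition riemannian_volume (R : realType) (d : nat) (M : smoothManifold R d)
    (g : riemannianMetric M) (vol : {measure set (borel M) -> \bar R}) : Prop :=
  forall (c : chart M) (A : set M),
    measurable (A : set (borel M)) -> A `<=` dom c ->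
    vol A = lebesgue_rV (fun x : 'rV[R]_d =>
      (\1_(coord c @` A) x * Num.sqrt (\det (g c x)))%:E).

Section sobolev.
Context (R : realType) (d D : nat) (M : smoothManifold R d).
Context (g : riemannianMetric M) (vol : {measure set (borel M) -> \bar R}).
Implicit Types f : M -> 'rV[R]_D.

Definition smooth_map f : Prop :=
  forall (c : chart M) (j : 'I_D),
    smooth_on (codom c) (fun x => f (param c x) ord0 j).

Definition L2_norm2 f : \bar R :=
  (\sum_(j < D) \int[vol]_p ((f p ord0 j) ^+ 2)%:E)%E.

Definition smooth_energy f : \bar R :=
  (\sum_(j < D) \int[vol]_p (hessian_norm2 g (fun q => f q ord0 j) p)%:E)%E.

Definition H2_norm2 f : \bar R := (L2_norm2 f + smooth_energy f)%E.

(* u is a Cauchy sequence of smooth maps in the H^2 norm and f is the L^2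
   function that represents its class in the completion. *)
Definition H2_approx f (u : nat -> M -> 'rV[R]_D) : Prop :=
  [/\ forall n, smooth_map (u n),
      forall eps : R, 0 < eps -> exists n0 : nat, forall m n : nat,
        (n0 <= m)%N -> (n0 <= n)%N ->
        (H2_norm2 (fun p => u m p - u n p)%R < eps%:E)%E &
      (fun n => L2_norm2 (fun p => u n p - f p)) @ \oo --> 0%E].

(* Elements of H^2 are identified with their continuous representatives. *)
Definition H2 : set (M -> 'rV[R]_D) :=
  [set f | continuous f /\ exists u, H2_approx f u].

(* Squared L^2 norm of the weak Hessian of f, i.e. of the L^2 limit of the
   Hessians of u n for an approximating sequence u. As the Hessian is a closable
   operator, the limit e is the same for all u; the infimum only names it. *)
Definition hessian_energy f : R :=
  inf [set e : R | exists2 u, H2_approx f u &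
                     (fun n => smooth_energy (u n)) @ \oo --> e%:E].

Definition supnorm f : R := sup [set enorm (f p) | p in [set: M]].

Definition sup_open (G : set (M -> 'rV[R]_D)) : Prop :=
  G `<=` [set f | continuous f] /\
  forall f, G f -> exists2 eps : R, 0 < eps &
    forall h : M -> 'rV[R]_D, continuous h ->
      supnorm (fun p => h p - f p) < eps -> G h.

Definition projection_index f (pi : 'rV[R]_D -> M) : Prop :=
  measurable_fun [set: borel 'rV[R]_D]
    (pi : borel 'rV[R]_D -> borel M) /\
  forall x p, enorm (x - f (pi x)) <= enorm (x - f p).

(* Topological support, for any function of sets. *)
Definition msupport (Q : set 'rV[R]_D -> \bar R) : set 'rV[R]_D :=
  [set x | forall U : set 'rV[R]_D, open U -> U x -> (0 < Q U)%E].

Definition rad0 (Q : set 'rV[R]_D -> \bar R) : R :=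
  sup [set enorm x | x in msupport Q].

Definition feasible (Q : set 'rV[R]_D -> \bar R) : set (M -> 'rV[R]_D) :=
  [set f | H2 f /\ supnorm f <= 2 * rad0 Q].

(* Here and below pi assigns a projection index to every map. *)
Definition loss (P : probability (borel 'rV[R]_D) R) (lambda : R)
    (pi : (M -> 'rV[R]_D) -> 'rV[R]_D -> M) f : \bar R :=
  (\int[P]_x (enorm ((x : 'rV[R]_D) - f (pi f x)) ^+ 2)%:E +
   (lambda * hessian_energy f)%:E)%E.

Definition empirical_loss (N : nat) (x : nat -> 'rV[R]_D) (lambda : R)
    (pi : (M -> 'rV[R]_D) -> 'rV[R]_D -> M) f : \bar R :=
  (N%:R^-1 * (\sum_(i < N) enorm (x i - f (pi f (x i))) ^+ 2) +
   lambda * hessian_energy f)%:E.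

Definition is_minimizer (L : (M -> 'rV[R]_D) -> \bar R)
    (F : set (M -> 'rV[R]_D)) f : Prop :=
  F f /\ forall h, F h -> (L f <= L h)%E.

End sobolev.

Definition empirical_measure (R : realType) (D N : nat) (x : nat -> 'rV[R]_D)
    (A : set 'rV[R]_D) : \bar R :=
  ((N%:R^-1)%:E * \sum_(i < N) \d_(x i : borel 'rV[R]_D) A)%E.

(* Independent and identically distributed with distribution P. *)
Definition iid (R : realType) (D : nat) (dO : measure_display)
    (Omega : measurableType dO) (Pr : probability Omega R)
    (P : probability (borel 'rV[R]_D) R)
    (X : nat -> Omega -> 'rV[R]_D) : Prop :=
  [/\ forall i, measurable_fun [set: Omega] (X i : Omega -> borel 'rV[R]_D),
      forall i (A : set (borel 'rV[R]_D)), measurable A ->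
        Pr (X i @^-1` A) = P A &
      forall (J : {fset nat}) (A : nat -> set (borel 'rV[R]_D)),
        (forall i, measurable (A i)) ->
        Pr (\bigcap_(i in [set` J]) X i @^-1` A i) =
        (\prod_(i <- J) Pr (X i @^-1` A i))%E].

Definition outer_probability (R : realType) (dO : measure_display)
    (Omega : measurableType dO) (Pr : probability Omega R) (A : set Omega) :
    \bar R :=
  ereal_inf [set Pr B | B in [set B | measurable B /\ A `<=` B]].

Definition cvg0_outer_probability (R : realType) (dO : measure_display)
    (Omega : measurableType dO) (Pr : probability Omega R)
    (Z : nat -> Omega -> R) : Prop :=
  forall eps : R, 0 < eps ->
    (fun N => outer_probability Pr [set w | eps < `|Z N w|]) @ \oo --> 0%E.

(* Main.v *)
Require Import Defs.
From HB Require Import structures.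
From mathcomp Require Import all_boot all_order all_algebra finmap.
From mathcomp Require Import all_classical all_reals all_analysis.
From mathcomp Require Import measurable_realfun ring lra.

Import Order.TTheory GRing.Theory Num.Theory.
Import numFieldNormedType.Exports.

Local Open Scope classical_set_scope.
Local Open Scope ring_scope.

(** The empirical and the population loss of a map f have the same energy term, so
they differ as the average of x |-> |x - f (pi_f x)|^2 over the sample differs
from its expectation.  As the minimizers are random, this difference has to be
small uniformly in f.

The function x |-> |x - f (pi_f x)|^2 is the squared distance from x to the
image of f.  With r the radius of the support K of P, a map bounded by 2 r has
squared distances that are bounded by (3 r)^2 and 6 r-Lipschitz on K, whatever
the map.  If K is cut
into finitely many small cells, all these functions are simultaneously close to
functions that are constant on cells, and their averages are controlled by the
frequencies of the cells ([uniform_risk_approx]).  Chebyshev's inequality for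
finitely many events ([iid_bad_events]) then gives events of probability O(1/N)
outside of which all averages are close to the expectations; these measurable
events also dominate the outer probability in the conclusion.

The minimizers range over different classes: f_N is bounded by twice the radius
r_N of the sample, f* by 2 r.  As r_N <= r almost surely, f_N competes with f*
in the population problem.  In the other direction f* itself may be too large,
and (r_N / r) f* is used as competitor in the empirical problem.  It lies in the
empirical class, its energy is at most that of f* ([hessian_energy_contract]),
and its squared distances exceed those of f* by at most 12 r^2 (1 - r_N / r)
([sq_proj_dist_shrink]), which is small as soon as one sample point falls in the
set where |x| > (1 - eta) r; that set has positive probability by the definition
of the support.

Together these bound the loss of f_N by the loss of f* plus an arbitrarily small
constant.  If f_N were not in the sup-norm ball of radius e around f*, this
would contradict the gap that local uniqueness provides outside of the ball. *)

(** * The Euclidean norm *)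

Section euclidean_norm.
Context {R : realType} {n : nat}.
Implicit Types x y z : 'rV[R]_n.

Lemma enorm_ge0 x : 0 <= enorm x.
Proof. exact: sqrtr_ge0. Qed.

Lemma sqr_enorm x : enorm x ^+ 2 = \sum_(i < n) x ord0 i ^+ 2.
Proof. by rewrite sqr_sqrtr// sumr_ge0// => i _; exact: sqr_ge0. Qed.

Lemma enorm0 : enorm (0 : 'rV[R]_n) = 0.
Proof.
by rewrite /enorm big1 ?sqrtr0// => i _; rewrite mxE expr0n.
Qed.

Lemma enormZ (a : R) x : 0 <= a -> enorm (a *: x) = a * enorm x.
Proof.
move=> a0; rewrite /enorm; under eq_bigr do rewrite mxE exprMn.
by rewrite -mulr_sumr sqrtrM ?sqr_ge0// sqrtr_sqr ger0_norm.
Qed.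

Lemma enormN x : enorm (- x) = enorm x.
Proof. by rewrite /enorm; under eq_bigr do rewrite mxE sqrrN. Qed.

Lemma enormB x y : enorm (x - y) = enorm (y - x).
Proof. by rewrite -enormN opprB. Qed.

(** Cauchy-Schwarz, from Lagrange's identity. *)
Lemma dot_le_enorm x y :
  \sum_(i < n) x ord0 i * y ord0 i <= enorm x * enorm y.
Proof.
set s := \sum_(i < n) _.
have [s0|s0] := leP s 0; first by apply: (le_trans s0); rewrite mulr_ge0 ?enorm_ge0.
rewrite -(@ler_pXn2r _ 2)// ?nnegrE ?mulr_ge0 ?enorm_ge0 ?(ltW s0)//.
rewrite exprMn !sqr_enorm.
set a := \sum_(i < n) x _ _ ^+ 2; set b := \sum_(i < n) _.
have : 0 <= \sum_(i < n) \sum_(j < n)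
    (x ord0 i * y ord0 j - x ord0 j * y ord0 i) ^+ 2.
  by apply: sumr_ge0 => i _; apply: sumr_ge0 => j _; exact: sqr_ge0.
suff -> : \sum_(i < n) \sum_(j < n)
    (x ord0 i * y ord0 j - x ord0 j * y ord0 i) ^+ 2 = (a * b - s ^+ 2) * 2.
  by rewrite pmulr_lge0// subr_ge0.
transitivity (\sum_(i < n) \sum_(j < n) (x ord0 i ^+ 2 * y ord0 j ^+ 2
   + x ord0 j ^+ 2 * y ord0 i ^+ 2
   - 2 * ((x ord0 i * y ord0 i) * (x ord0 j * y ord0 j)))).
  by apply: eq_bigr => i _; apply: eq_bigr => j _; ring.
under eq_bigr do rewrite sumrB big_split/= -mulr_sumr -mulr_suml -mulr_sumr
  -mulr_sumr.
rewrite sumrB big_split/= -!mulr_suml -!mulr_sumr -mulr_suml -/s -/a -/b.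
by ring.
Qed.

Lemma ler_enormD x y : enorm (x + y) <= enorm x + enorm y.
Proof.
rewrite -(@ler_pXn2r _ 2)// ?nnegrE ?addr_ge0 ?enorm_ge0//.
rewrite sqrrD !sqr_enorm.
under eq_bigr do rewrite mxE sqrrD.
by rewrite !big_split/= lerD2r lerD2l mulr2n lerD// dot_le_enorm.
Qed.

Lemma ler_enorm_add z x y : enorm (x - y) <= enorm (x - z) + enorm (z - y).
Proof. by rewrite -[x - y](subrKA z) ler_enormD. Qed.

Lemma ler_enormBD x y : enorm (x - y) <= enorm x + enorm y.
Proof. by rewrite -(enormN y) ler_enormD. Qed.

Lemma continuous_enorm : continuous (@enorm R n).
Proof.
move=> x; apply: continuous_comp; last exact: sqrt_continuous.
apply: (@continuous_big _ _ _ _ _ add_continuous 'rV[R]_n _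
  (fun i (y : 'rV[R]_n) => y ord0 i ^+ 2)) => i _ y.
apply: (@continuous_comp _ _ _ (fun y : 'rV[R]_n => y ord0 i) (fun r => r ^+ 2)).
  exact: coord_continuous.
exact: exprn_continuous.
Qed.

Lemma enorm_cvg0 x (e : R) : 0 < e -> \forall y \near x, enorm (y - x) < e.
Proof.
move=> e0; have : (fun y => enorm (y - x)) @ x --> enorm (x - x).
  apply: continuous_comp; last exact: continuous_enorm.
  by apply: continuousB; [exact: cvg_id|exact: cst_continuous].
rewrite subrr enorm0 =>
    /(@cvgrPdist_lt _ _ _ (nbhs x) (nbhs_filter x))/(_ e e0); apply: filterS => y.
by rewrite sub0r normrN ger0_norm// enorm_ge0.
Qed.

Lemma open_enorm_ball x (e : R) : open [set y | enorm (y - x) < e].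
Proof.
have c : continuous (fun y => enorm (y - x)).
  move=> y; apply: continuous_comp; last exact: continuous_enorm.
  by apply: continuousB; [exact: cvg_id|exact: cst_continuous].
have -> : [set y | enorm (y - x) < e] =
  (fun y => enorm (y - x)) @^-1` [set z | z < e] by [].
by apply: open_comp => [y _|]; [exact: c|exact: open_lt].
Qed.

Lemma enorm_lipschitz_continuous (f : 'rV[R]_n -> R) :
  (forall x y, f x <= enorm (x - y) + f y) -> continuous f.
Proof.
move=> fL x.
apply: (proj2 (@cvgrPdist_lt _ _ _ (nbhs x) (nbhs_filter x) _ _)) => e e0; near=> y.
have : enorm (y - x) < e by near: y; exact: enorm_cvg0.
apply: le_lt_trans; rewrite ler_norml.
have := fL x y; have := fL y x; rewrite (enormB x y); lra.
Unshelve. all: by end_near. Qed.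

End euclidean_norm.

(** * Borel sets and the support of a measure *)

Section borel.
Context {R : realType} {n : nat}.

Lemma borel_open (U : set 'rV[R]_n) :
  open U -> measurable (U : set (borel 'rV[R]_n)).
Proof. exact: sub_sigma_algebra. Qed.

Lemma borel_closed (U : set 'rV[R]_n) :
  closed U -> measurable (U : set (borel 'rV[R]_n)).
Proof.
move=> cU.
have H : measurable (~` U : set (borel 'rV[R]_n)).
  by apply: borel_open; exact: closed_openC.
by rewrite -[U]setCK; apply: measurableC.
Qed.

Lemma borel_continuous (f : 'rV[R]_n -> R) : continuous f ->
  measurable_fun [set: borel 'rV[R]_n] (f : borel 'rV[R]_n -> R).
Proof.
move=> cf; apply: (@measurability _ _ (borel 'rV[R]_n) R _ f _
  (RGenOInfty.measurableE R)).
move=> _ [_ [a ->] <-]; rewrite setTI; apply: borel_open.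
rewrite set_itvE; apply: open_comp => [x _|]; [exact: cf|exact: open_gt].
Qed.

End borel.

Section support.
Context {R : realType} {n : nat}.

Lemma closed_msupport (Q : set 'rV[R]_n -> \bar R) : closed (msupport Q).
Proof.
rewrite -openC openE => x /existsNP[U /not_implyP[oU /not_implyP[Ux QU]]].
by apply: filterS (open_nbhs_nbhs (conj oU Ux)) => y Uy /(_ U oU Uy).
Qed.

Lemma ratr_approx (x : 'rV[R]_n) (e : R) : 0 < e ->
  exists q : 'rV[rat]_n, ball (map_mx ratr q : 'rV[R]_n) e x.
Proof.
move=> e0.
have /choice[q qP] (i : 'I_n) : exists q : rat, `|ratr q - x ord0 i| < e.
  have [q /=] := @rat_in_itvoo R (x ord0 i - e) (x ord0 i + e) ltac:(lra).
  by rewrite in_itv/= => /andP[q1 q2]; exists q; rewrite ltr_norml; lra.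
exists (\row_i q i); split=> // i j; rewrite !mxE (ord1 i); exact: qP.
Qed.

(** The space is covered by countably many rational balls, so the complement of
the support is a countable union of null balls. *)
Lemma msupport_full (mu : {measure set (borel 'rV[R]_n) -> \bar R}) :
  mu (~` msupport mu) = 0%E.
Proof.
pose B (u : 'rV[rat]_n * nat) := ball (map_mx ratr u.1 : 'rV[R]_n) u.2.+1%:R^-1.
have oB u : open (B u) by apply: ball_open; rewrite invr_gt0.
pose V k : set (borel 'rV[R]_n) :=
  if (choice.unpickle k : option ('rV[rat]_n * nat)) is Some u then
  (if mu (B u) == 0%E then B u else set0) else set0.
have mV k : measurable (V k).
  rewrite /V; case: choice.unpickle => // u; case: ifPn => // _; exact: borel_open.
have V0 k : mu (V k) = 0%E.
  by rewrite /V; case: choice.unpickle => [u|] //; case: ifPn => [/eqP|].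
have mC : measurable (~` msupport mu : set (borel 'rV[R]_n)).
  by apply: borel_open; apply: closed_openC; exact: closed_msupport.
apply: (proj1 (@negligibleP _ (borel 'rV[R]_n) R mu _ mC)).
apply: (@negligibleS _ _ _ mu (\bigcup_k V k)); last first.
  apply: negligible_bigcup => k.
  exact: (proj2 (@negligibleP _ (borel 'rV[R]_n) R mu _ (mV k)) (V0 k)).
move=> x /existsNP[U /not_implyP[oU /not_implyP[Ux /negP]]].
rewrite -leNgt => U0.
have /nbhs_ballP[e /= e0 eU] := open_nbhs_nbhs (conj oU Ux).
have [k] := @ltr_add_invr R 0 (e / 2) ltac:(lra).
rewrite add0r => ke.
have [q qx] := ratr_approx x (k.+1%:R^-1) ltac:(by rewrite invr_gt0).
exists (choice.pickle (q, k)) => //; rewrite /V choice.pickleK ifT//.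
rewrite eq_le measure_ge0 andbT (le_trans _ U0)//.
apply: le_measure; rewrite ?inE; [exact: borel_open|exact: borel_open|].
move=> y qy; apply: eU; rewrite [e]splitr; apply: ball_triangle.
  by apply: (le_ball (ltW ke)); apply: ball_sym; exact: qx.
exact: (le_ball (ltW ke)).
Qed.

End support.

(** * A weak law of large numbers for events *)

Section weak_law.
Context {R : realType} {dO : measure_display} {T : measurableType dO}.
Context (P : probability T R) (E : nat -> set T) (p : R).
Hypothesis mE : forall i, measurable (E i).
Hypothesis PE : forall i, P (E i) = p%:E.
Hypothesis PEE : forall i j, i != j -> P (E i `&` E j) = (p ^+ 2)%:E.

Let S N (w : T) : R := \sum_(i < N) \1_(E i) w.

Let mS N : measurable_fun [set: T] (S N).
Proof. by apply: measurable_sum => i; exact: measurable_indic. Qed.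

Let S_ge0 N w : 0 <= S N w.
Proof. by apply: sumr_ge0 => i _. Qed.

Let mSE N : measurable_fun [set: T] (fun w => (S N w)%:E).
Proof. exact/measurable_EFinP. Qed.

Let SE_ge0 N w : [set: T] w -> (0 <= (S N w)%:E)%E.
Proof. by rewrite lee_fin. Qed.

Lemma integral_indic_sum N : (\int[P]_w (S N w)%:E = (N%:R * p)%:E)%E.
Proof.
under eq_integral do rewrite /S -sumEFin.
rewrite ge0_integral_sum; [|by []| |by move=> i w _; rewrite lee_fin]; last first.
  by move=> i; apply/measurable_EFinP; exact: measurable_indic.
transitivity (\sum_(i < N) p%:E)%E.
  by apply: eq_bigr => i _; rewrite integral_indic// setIT; exact: PE.
by rewrite sumEFin sumr_const card_ord mulr_natl.
Qed.

Lemma integral_indic_sum_sqr N :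
  (\int[P]_w (S N w ^+ 2)%:E = (N%:R ^+ 2 * p ^+ 2 + N%:R * (p - p ^+ 2))%:E)%E.
Proof.
have SS w : (S N w ^+ 2)%:E =
    (\sum_(i < N) \sum_(j < N) (\1_(E i `&` E j) w)%:E)%E.
  rewrite expr2 /S big_distrlr/= -sumEFin; apply: eq_bigr => i _.
  by rewrite -sumEFin; apply: eq_bigr => j _; rewrite indicI.
have mEE i j : measurable (E i `&` E j) by exact: measurableI.
under eq_integral do rewrite SS.
rewrite ge0_integral_sum; [|by []| |]; last 2 first.
- move=> i; apply: emeasurable_sum => j.
  by apply/measurable_EFinP; exact: measurable_indic.
- by move=> i w _; apply: sume_ge0 => j _; rewrite lee_fin.
transitivity (\sum_(i < N) (N%:R * p ^+ 2 + (p - p ^+ 2))%:E)%E; last first.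
  rewrite sumEFin sumr_const card_ord -mulr_natl; congr (_%:E); ring.
apply: eq_bigr => i _.
rewrite ge0_integral_sum; [|by []| |by move=> j w _; rewrite lee_fin]; last first.
  by move=> j; apply/measurable_EFinP; exact: measurable_indic.
transitivity (\sum_(j < N) (p ^+ 2 + (j == i)%:R * (p - p ^+ 2))%:E)%E.
  apply: eq_bigr => j _; transitivity (P (E i `&` E j)).
    by rewrite integral_indic// setIT.
  have [->|ji] := eqVneq j i; first by rewrite setIid PE mul1r addrC subrK.
  by rewrite PEE 1?eq_sym// mul0r addr0.
rewrite sumEFin big_split/= sumr_const card_ord -mulr_suml -natr_sum.
by rewrite (bigD1 i)//= eqxx big1 ?addn0 ?mul1r ?mulr_natl// => j /negbTE->.
Qed.

Lemma measurable_deviation N (e : R) :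
  measurable [set w | e <= `|N%:R^-1 * S N w - p|].
Proof.
rewrite -[X in measurable X]setTI.
have -> : [set w | e <= `|N%:R^-1 * S N w - p|] =
  (fun w => `|N%:R^-1 * S N w - p|) @^-1` `[e, +oo[%classic.
  by apply/seteqP; split => w /=; rewrite in_itv/= andbT.
have mf : measurable_fun [set: T] (fun w => N%:R^-1 * S N w - p).
  by apply: measurable_funB => //; exact: measurable_funM.
by apply: (measurableT_comp (@normr_measurable R setT) mf).
Qed.

(** The variance of a sum of N pairwise independent indicators is N (p - p^2);
the claim is then Chebyshev's inequality. *)
Lemma weak_law_events N (e : R) : (0 < N)%N -> 0 < e ->
  (P [set w | (e <= `|N%:R^-1 * S N w - p|)%R]
     <= ((p - p ^+ 2) / e ^+ 2 * N%:R^-1)%:E)%E.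
Proof.
move=> N0 e0; set B := [set w | _].
have n0 : 0 < N%:R :> R by rewrite ltr0n.
pose Y w := (S N w - N%:R * p) ^+ 2.
have mY : measurable_fun [set: T] Y.
  by apply: measurable_funX; apply: measurable_funB.
have mB : measurable B by exact: measurable_deviation.
have Y0 w : 0 <= Y w by exact: sqr_ge0.
have p0 : 0 <= p by rewrite -lee_fin -(PE 0%N).
have IY : (\int[P]_w (Y w)%:E = (N%:R * (p - p ^+ 2))%:E)%E.
  have key : (\int[P]_w (Y w)%:E + (2 * N%:R * p * (N%:R * p))%:E =
     (N%:R ^+ 2 * p ^+ 2 + N%:R * (p - p ^+ 2) + (N%:R * p) ^+ 2)%:E)%E.
    rewrite [in LHS]EFinM -integral_indic_sum EFinD -integral_indic_sum_sqr.
    rewrite -(ge0_integralZl_EFin P measurableT (SE_ge0 N) (mSE N)); last first.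
      by rewrite !mulr_ge0.
    rewrite -ge0_integralD//; last first.
    - by apply: measurable_funeM; exact: mSE.
    - by move=> w _; rewrite -EFinM lee_fin !mulr_ge0.
    - exact/measurable_EFinP.
    - by move=> w _; rewrite lee_fin.
    have -> : ((N%:R * p) ^+ 2)%:E = (\int[P]_w ((N%:R * p) ^+ 2)%:E)%E.
      by rewrite integral_cst// [X in (_ * X)%E](@probability_setT _ _ _ P) mule1.
    rewrite -ge0_integralD//; last first.
    - by move=> w _; rewrite lee_fin sqr_ge0.
    - by apply/measurable_EFinP; exact: measurable_funX.
    - by move=> w _; rewrite lee_fin sqr_ge0.
    by apply: eq_integral => w _; rewrite -EFinM -!EFinD /Y; congr (_%:E); ring.
  move: key; case: (\int[P]_w _)%E => [r|//|//] [h]; congr (_%:E).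
  by apply: (addIr (2 * N%:R * p * (N%:R * p))); rewrite h; ring.
have : (((N%:R * e) ^+ 2)%:E * P B <= \int[P]_w (Y w)%:E)%E.
  rewrite -[B in P B]setIT -integral_indic// -ge0_integralZl_EFin ?sqr_ge0//;
    last by apply/measurable_EFinP; exact: measurable_indic.
  apply: ge0_le_integral => //.
  - by move=> w _; rewrite -EFinM lee_fin mulr_ge0 ?sqr_ge0.
  - by apply/measurable_EFinP; apply: measurable_funM => //; exact: measurable_indic.
  - exact/measurable_EFinP.
  - move=> w _; rewrite -EFinM lee_fin indicE.
    have [|_] := boolP (w \in B); last by rewrite mulr0.
    rewrite inE /B/= mulr1 => Bw.
    have -> : Y w = (N%:R * `|N%:R^-1 * S N w - p|) ^+ 2.
      rewrite exprMn real_normK ?num_real// -exprMn /Y; congr (_ ^+ 2).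
      by field; rewrite gt_eqF.
    by rewrite ler_pXn2r ?nnegrE ?mulr_ge0 ?(ltW n0) ?(ltW e0)// ler_pM2l.
rewrite IY -lee_pdivlMl ?exprn_gt0 ?mulr_gt0// => /le_trans; apply.
rewrite -EFinM lee_fin le_eqVlt; apply/orP; left; apply/eqP.
by field; rewrite !gt_eqF.
Qed.

End weak_law.

(** * Scaling of the Hessian energy *)

(** Scaling by c maps the simple functions below f onto those below c f.  Arguing
on simple functions allows the Hessian norm, a combination of limits of
difference quotients in varying charts, to be integrated as it stands. *)
Lemma ge0_integralZl_real {dT : measure_display} {T : measurableType dT}
    {R : realType} (mu : {measure set T -> \bar R}) (f : T -> R) (c : R) :
  0 < c -> (forall x, 0 <= f x) ->
  (\int[mu]_x (c * f x)%:E = c%:E * \int[mu]_x (f x)%:E)%E.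
Proof.
have half (k : R) (h : T -> R) : 0 < k -> (forall x, 0 <= h x) ->
    (k%:E * \int[mu]_x (h x)%:E <= \int[mu]_x (k * h x)%:E)%E.
  move=> k0 h0; rewrite -lee_pdivlMl//.
  rewrite (@ge0_integralTE _ _ _ mu (fun x => (h x)%:E))//=.
  apply: ge_ereal_sup => _ [s /= sh <-]; rewrite lee_pdivlMl//.
  rewrite ge0_integralTE/=; last by move=> x; rewrite lee_fin mulr_ge0// ltW.
  apply: ereal_sup_ubound; exists (scale_nnsfun s (ltW k0)) => /=.
    by move=> x; rewrite lee_fin ler_pM2l// -lee_fin.
  exact: (@sintegralrM _ _ _ mu k s).
move=> c0 f0; apply/eqP; rewrite eq_le half// andbT.
rewrite -lee_pdivrMl//; apply: le_trans (half c^-1 _ _ _) _.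
- by rewrite invr_gt0.
- by move=> x; rewrite mulr_ge0// ltW.
- by under eq_integral do rewrite mulKf ?gt_eqF//.
Qed.

(** If one of the limits does not exist, neither does the other, and both are 0
by convention. *)
Lemma lim_mulr {T : Type} {R : realType} (F : set_system T) (t : R)
    (f : T -> R) : ProperFilter F -> t != 0 ->
  lim ((fun x => t * f x) @ F) = t * lim (f @ F).
Proof.
move=> FF t0; have [cf|ncf] := pselect (cvg (f @ F)).
  apply: (@cvg_lim _ (@Rhausdorff R)).
  by apply: cvgM => //; exact: cvg_cst.
have ncg : ~ cvg ((fun x => t * f x) @ F).
  move=> /cvg_ex[l gl]; apply: ncf; apply/cvg_ex; exists (t^-1 * l).
  have -> : f = (fun x => t^-1 * (t * f x)).
    by apply/funext => x; rewrite mulKf.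
  by apply: cvgM => //; exact: cvg_cst.
by rewrite (dvgP ncg) (dvgP ncf) mulr0.
Qed.

Section scaling_derivatives.
Context {R : realType} {n : nat}.

Lemma pderiv_ext (A : set 'rV[R]_n) i (f h : 'rV[R]_n -> R) x : A x ->
  (forall y, A y -> f y = h y) -> pderiv A i f x = pderiv A i h x.
Proof.
move=> Ax fh; rewrite /pderiv; congr (lim _); apply/funext => B.
pose q (h : 'rV[R]_n -> R) (r : R) :=
  r^-1 * (h (x + r *: delta_mx ord0 i) - h x).
suff : (\forall r \near within [set r : R | A (x + r *: delta_mx ord0 i)] 0^',
    B (q f r)) =
  (\forall r \near within [set r : R | A (x + r *: delta_mx ord0 i)] 0^',
    B (q h r)) by [].
apply/propext; rewrite !near_withinE /q; split; apply: filterS => r + r0 Ar;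
  by move=> /(_ r0 Ar); rewrite (fh _ Ar) (fh _ Ax).
Qed.

Lemma derive_scale (v x : 'rV[R]_n) (t : R) (f : 'rV[R]_n -> R) : t != 0 ->
  'D_v (fun y => t * f y) x = t * 'D_v f x.
Proof.
move=> t0; rewrite /derive -lim_mulr//; congr (lim _).
apply: (congr1 (fun q : R -> R => q @ 0^')); apply/funext => r /=.
by rewrite /GRing.scale/= -mulrBr mulrCA.
Qed.

Lemma Ck_open_scale k (U : set 'rV[R]_n) (t : R) (f : 'rV[R]_n -> R) :
  t != 0 -> Ck_open k U f -> Ck_open k U (fun y => t * f y).
Proof.
move=> t0; elim: k f => [|k IH] f [cf df]; split=> //.
- by move=> x Ux; apply: (@continuousM _ _ (cst t)); [exact: cst_continuous|exact: cf].
- by move=> x Ux; apply: (@continuousM _ _ (cst t)); [exact: cst_continuous|exact: cf].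
move=> i; have [dfi Cfi] := df i; split.
  by move=> x Ux; apply: (@derivableZ _ _ _ f t); exact: dfi.
have -> : (fun x => 'D_(delta_mx ord0 i) (fun y => t * f y) x) =
    (fun x => t * 'D_(delta_mx ord0 i) f x).
  by apply/funext => x; rewrite derive_scale.
exact: IH.
Qed.

Lemma smooth_on_scale (A : set 'rV[R]_n) (t : R) (f : 'rV[R]_n -> R) :
  t != 0 -> smooth_on A f -> smooth_on A (fun y => t * f y).
Proof.
move=> t0 sf x Ax; have [U [F [oU Ux CF Ff]]] := sf x Ax.
exists U, (fun y => t * F y); split=> //.
  by move=> k; exact: Ck_open_scale.
by move=> y Ay Uy; rewrite Ff.
Qed.

End scaling_derivatives.

Section scaling_hessian.
Context {R : realType} {d : nat} {M : smoothManifold R d}.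
Context (g : riemannianMetric M).

(** Every point of a chart codomain can be moved a little in each positive
coordinate direction, so the one-sided difference quotients live on a proper
filter. *)
Lemma pderiv_proper_filter (c : chart M) (x : 'rV[R]_d) i : Defs.codom c x ->
  ProperFilter (within [set h : R | Defs.codom c (x + h *: delta_mx ord0 i)] 0^').
Proof.
have [W oW cW] := coord_open c; rewrite /Defs.codom cW => -[Wx Hx].
apply: Build_ProperFilter_ex => B; rewrite /within/= => BP.
have cx : (fun h : R => x + h *: delta_mx ord0 i) @ 0^'+ --> x.
  apply: cvg_at_right_filter; rewrite -[X in _ --> X]addr0.
  apply: cvgD; first exact: cvg_cst.
  rewrite -[X in _ --> X](scale0r (delta_mx ord0 i : 'rV[R]_d)).
  by apply: cvgZl; exact: cvg_id.
have BP' : \forall h \near (0 : R)^'+, h != 0 ->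
    (W `&` half_space d) (x + h *: delta_mx ord0 i) -> B h.
  by apply: cvg_within; exact: BP.
near (0 : R)^'+ => h.
have h0 : 0 < h by near: h; exact: nbhs_right_gt.
exists h; have : h != 0 -> (W `&` half_space d) (x + h *: delta_mx ord0 i) -> B h.
  by near: h.
apply; first by rewrite gt_eqF.
split; first by near: h; apply: cx; exact: open_nbhs_nbhs.
move=> j j0; rewrite !mxE addr_ge0 ?Hx// mulr_ge0 ?(ltW h0)//.
Unshelve. all: by end_near. Qed.

Lemma pderiv_scale (c : chart M) (x : 'rV[R]_d) i (t : R) f : Defs.codom c x ->
  t != 0 -> pderiv (Defs.codom c) i (fun y => t * f y) x =
  t * pderiv (Defs.codom c) i f x.
Proof.
move=> cx t0; have FF := pderiv_proper_filter c x i cx; rewrite /pderiv -lim_mulr//.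
congr (lim _); apply: (congr1 (fun q : R -> R => q @ _)).
by apply/funext => r; rewrite -mulrBr mulrCA.
Qed.

Lemma hessian_scale (f : M -> R) (c : chart M) (x : 'rV[R]_d) (t : R) :
  Defs.codom c x -> t != 0 ->
  hessian g (fun p => t * f p) c x = t *: hessian g f c x.
Proof.
move=> cx t0; apply/matrixP => i j; rewrite !mxE mulrBr; congr (_ - _).
  rewrite -pderiv_scale//; apply: pderiv_ext => // y cy.
  by rewrite pderiv_scale.
rewrite mulr_sumr; apply: eq_bigr => k _.
by rewrite pderiv_scale// mulrCA.
Qed.

Lemma hessian_norm2_scale (f : M -> R) (p : M) (t : R) : t != 0 ->
  hessian_norm2 g (fun p => t * f p) p = t ^+ 2 * hessian_norm2 g f p.
Proof.
move=> t0; rewrite /hessian_norm2 hessian_scale//; last first.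
  by exists p => //; exact: chart_atP.
rewrite /tensor_norm2 mulr_sumr; apply: eq_bigr => i _.
rewrite mulr_sumr; apply: eq_bigr => k _.
by rewrite -scalemxAr -scalemxAl mxE exprMn.
Qed.

Lemma hessian_norm2_ge0 (f : M -> R) (p : M) : 0 <= hessian_norm2 g f p.
Proof.
by apply: sumr_ge0 => i _; apply: sumr_ge0 => k _; exact: sqr_ge0.
Qed.

Context {D : nat} (vol : {measure set (borel M) -> \bar R}).
Implicit Types f : M -> 'rV[R]_D.

Lemma smooth_energy_ge0 f : (0 <= smooth_energy g vol f)%E.
Proof.
apply: sume_ge0 => j _; apply: integral_ge0 => p _.
by rewrite lee_fin hessian_norm2_ge0.
Qed.

Lemma L2_norm2_ge0 f : (0 <= L2_norm2 vol f)%E.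
Proof.
apply: sume_ge0 => j _; apply: integral_ge0 => p _.
by rewrite lee_fin sqr_ge0.
Qed.

Lemma smooth_energy_scale f (t : R) : 0 < t ->
  smooth_energy g vol (fun p => t *: f p) =
  ((t ^+ 2)%:E * smooth_energy g vol f)%E.
Proof.
move=> t0; rewrite /smooth_energy ge0_sume_distrr; last first.
  by move=> j _; apply: integral_ge0 => p _; rewrite lee_fin hessian_norm2_ge0.
apply: eq_bigr => j _; rewrite -ge0_integralZl_real ?exprn_gt0//; last first.
  by move=> p; exact: hessian_norm2_ge0.
have -> : (fun q => (t *: f q) ord0 j) = (fun q => t * f q ord0 j).
  by apply/funext => q; rewrite mxE.
by apply: eq_integral => p _; rewrite hessian_norm2_scale// gt_eqF.
Qed.

Lemma L2_norm2_scale f (t : R) : 0 < t ->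
  L2_norm2 vol (fun p => t *: f p) = ((t ^+ 2)%:E * L2_norm2 vol f)%E.
Proof.
move=> t0; rewrite /L2_norm2 ge0_sume_distrr; last first.
  by move=> j _; apply: integral_ge0 => p _; rewrite lee_fin sqr_ge0.
apply: eq_bigr => j _; rewrite -ge0_integralZl_real ?exprn_gt0//; last first.
  by move=> p; exact: sqr_ge0.
by apply: eq_integral => p _; rewrite mxE exprMn.
Qed.

Lemma H2_approx_scale f u (t : R) : 0 < t -> H2_approx g vol f u ->
  H2_approx g vol (fun p => t *: f p) (fun n p => t *: u n p).
Proof.
move=> t0 [su cu lu]; split.
- move=> n c j; have := @smooth_on_scale R d _ t _ _ (su n c j).
  rewrite gt_eqF// => /(_ isT).
  by congr (smooth_on _ _); apply/funext => x; rewrite mxE.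
- move=> e e0; have [n0 n0P] := cu (e / t ^+ 2) ltac:(by rewrite divr_gt0// exprn_gt0).
  exists n0 => m n mn nn.
  have -> : (fun p => t *: u m p - t *: u n p) =
      (fun p => t *: (u m p - u n p)).
    by apply/funext => p; rewrite scalerBr.
  rewrite /H2_norm2 L2_norm2_scale// smooth_energy_scale//.
  rewrite -ge0_muleDr ?L2_norm2_ge0 ?smooth_energy_ge0//.
  by rewrite -lte_pdivlMl ?exprn_gt0// -EFinM mulrC; exact: n0P.
- have -> : (fun n => L2_norm2 vol (fun p => t *: u n p - t *: f p)) =
      (fun n => (t ^+ 2)%:E * L2_norm2 vol (fun p => u n p - f p)%R)%E.
    apply/funext => n; rewrite -L2_norm2_scale//; congr (L2_norm2 _ _).
    by apply/funext => p; rewrite scalerBr.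
  by rewrite -(mule0 (t ^+ 2)%:E); apply: cvgeZl.
Qed.

Lemma H2_scale f (t : R) : 0 < t -> H2 g vol f -> H2 g vol (fun p => t *: f p).
Proof.
move=> t0 [cf [u fu]]; split.
  by move=> p; apply: cvgZr; exact: cf.
by exists (fun n p => t *: u n p); exact: H2_approx_scale.
Qed.

Let energies f : set R := [set e : R | exists2 u, H2_approx g vol f u &
  (fun n => smooth_energy g vol (u n)) @ \oo --> e%:E].

Let energies_scale f (t : R) (e : R) : 0 < t -> energies f e ->
  energies (fun p => t *: f p) (t ^+ 2 * e).
Proof.
move=> t0 [u fu ue]; exists (fun n p => t *: u n p); first exact: H2_approx_scale.
have -> : (fun n => smooth_energy g vol (fun p => t *: u n p)) =
    (fun n => (t ^+ 2)%:E * smooth_energy g vol (u n))%E.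
  by apply/funext => n; rewrite smooth_energy_scale.
by rewrite [(t ^+ 2 * e)%:E]EFinM; apply: cvgeZl.
Qed.

Let energies_ge0 f : lbound (energies f) 0.
Proof.
move=> e [u _ ue]; rewrite -lee_fin -(cvg_lim (@ereal_hausdorff R) ue).
apply: lime_ge; first exact: cvgP ue.
by apply: nearW => n; exact: smooth_energy_ge0.
Qed.

(** The energy is homogeneous of degree 2. *)
Lemma hessian_energy_contract f (t : R) : 0 < t -> t <= 1 ->
  hessian_energy g vol (fun p => t *: f p) <= hessian_energy g vol f.
Proof.
move=> t0 t1; rewrite /hessian_energy -/(energies f) -/(energies _).
have ti0 : 0 < t^-1 by rewrite invr_gt0.
have lbt : has_lbound (energies (fun p => t *: f p)).
  by exists 0; exact: energies_ge0.
have [e0|/set0P ne] := eqVneq (energies f) set0.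
  suff -> : energies (fun p => t *: f p) = set0 by rewrite e0.
  apply/seteqP; split=> // e /(energies_scale _ t^-1 _ ti0).
  suff -> : (fun p => t^-1 *: (t *: f p)) = f by rewrite e0.
  by apply/funext => p; rewrite scalerA mulVf ?gt_eqF// scale1r.
apply: lb_le_inf => // e fe; have e0 : 0 <= e := energies_ge0 _ _ fe.
apply: le_trans (_ : t ^+ 2 * e <= _).
  by apply: ge_inf => //; exact: energies_scale.
by rewrite ler_piMl// exprn_ile1// ltW.
Qed.

End scaling_hessian.

(** * Supremum norm and distance to the image of a map *)

Section projection_distance.
Context {R : realType} {d D : nat} {M : smoothManifold R d}.
Hypothesis hcompact : compact [set: M].
Implicit Types (f : M -> 'rV[R]_D) (x y : 'rV[R]_D).

Lemma enorm_le_supnorm f p : continuous f -> enorm (f p) <= supnorm f.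
Proof.
move=> cf; apply: ub_le_sup; last by exists p.
have : compact ((fun q => enorm (f q)) @` [set: M]).
  apply: continuous_compact => //; apply: continuous_subspaceT => q.
  by apply: continuous_comp; [exact: cf|exact: continuous_enorm].
move=> /compact_bounded[B [_ HB]]; exists (B + 1) => _ [q _ <-].
apply: le_trans (ler_norm _) _; apply: (HB (B + 1)); first by rewrite ltrDl.
by exists q.
Qed.

Lemma supnorm_le f (b : R) : (forall p, enorm (f p) <= b) -> supnorm f <= b.
Proof.
move=> fb; apply: ge_sup => [|_ [p _ <-]]; last exact: fb.
by exists (enorm (f point)), point.
Qed.

Lemma supnorm_ge0 f : continuous f -> 0 <= supnorm f.
Proof. by move=> cf; apply: le_trans (enorm_le_supnorm f point cf); exact: enorm_ge0. Qed.

Lemma supnorm_triangle f h k : continuous (fun p => f p - h p) ->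
  continuous (fun p => h p - k p) ->
  supnorm (fun p => f p - k p) <=
  supnorm (fun p => f p - h p) + supnorm (fun p => h p - k p).
Proof.
move=> cfh chk; apply: supnorm_le => p.
by apply: le_trans (ler_enorm_add (h p) _ _) _; apply: lerD;
  [exact: (enorm_le_supnorm _ p cfh)|exact: (enorm_le_supnorm _ p chk)].
Qed.

Lemma sup_open_ball f (e : R) : continuous f ->
  sup_open [set h : M -> 'rV[R]_D | continuous h /\ supnorm (fun p => h p - f p) < e].
Proof.
move=> cf; split=> [h []//|h [ch he]].
exists (e - supnorm (fun p => h p - f p)); first by rewrite subr_gt0.
move=> k ck kh; split=> //.
have cB (u v : M -> 'rV[R]_D) : continuous u -> continuous v ->
    continuous (fun p => u p - v p).
  by move=> cu cv p; apply: cvgB; [exact: cu|exact: cv].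
apply: le_lt_trans (supnorm_triangle k h f _ _) _; [exact: cB|exact: cB|].
by rewrite -ltrBrDr.
Qed.

Section one_map.
Context (f : M -> 'rV[R]_D) (pif : 'rV[R]_D -> M).
Hypotheses (cf : continuous f) (fP : projection_index f pif).

Lemma proj_dist_lip x y :
  enorm (x - f (pif x)) <= enorm (x - y) + enorm (y - f (pif y)).
Proof. by apply: le_trans (fP.2 x (pif y)) _; exact: ler_enorm_add. Qed.

Lemma measurable_sq_proj_dist : measurable_fun [set: borel 'rV[R]_D]
  (fun x : borel 'rV[R]_D => enorm ((x : 'rV[R]_D) - f (pif x)) ^+ 2).
Proof.
apply: measurable_funX.
apply: (borel_continuous (fun x => enorm (x - f (pif x)))).
exact: enorm_lipschitz_continuous proj_dist_lip.
Qed.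

Context (r : R).
Hypothesis fr : supnorm f <= 2 * r.

(** The constants below come from |x| <= r and |f| <= 2 r: distances are at most
3 r, so that a difference of squares is at most 6 r times the difference. *)
Lemma proj_dist_le x : enorm x <= r -> enorm (x - f (pif x)) <= 3 * r.
Proof.
move=> xr; apply: le_trans (ler_enormBD _ _) _.
have -> : 3 * r = r + 2 * r by ring.
exact/lerD/(le_trans (enorm_le_supnorm f (pif x) cf)).
Qed.

Lemma sq_proj_dist_lip x y : enorm x <= r -> enorm y <= r ->
  enorm (x - f (pif x)) ^+ 2 <=
  enorm (y - f (pif y)) ^+ 2 + 6 * r * enorm (x - y).
Proof.
move=> xr yr; have := proj_dist_lip x y.
have := proj_dist_le _ xr; have := proj_dist_le _ yr.
have := enorm_ge0 (x - y); have := enorm_ge0 (x - f (pif x)).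
have := enorm_ge0 (y - f (pif y)).
set a := enorm (x - f _); set b := enorm (y - f _); set c := enorm (x - y).
by nra.
Qed.

(** Moving the image towards the origin by a factor t moves each of its points
by at most (1 - t) 2 r, and the sum of two distances is at most 6 r. *)
Lemma sq_proj_dist_shrink (t : R) pif' x : 0 <= t -> t <= 1 ->
  projection_index (fun p => t *: f p) pif' -> enorm x <= r ->
  enorm (x - t *: f (pif' x)) ^+ 2 <=
  enorm (x - f (pif x)) ^+ 2 + 12 * r ^+ 2 * (1 - t).
Proof.
move=> t0 t1 tP xr.
have fx := enorm_le_supnorm f (pif x) cf.
have h1 : enorm (x - t *: f (pif' x)) <=
    enorm (x - f (pif x)) + (1 - t) * (2 * r).
  apply: le_trans (tP.2 x (pif x)) _.
  apply: le_trans (ler_enorm_add (f (pif x)) _ _) _; rewrite lerD2l.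
  rewrite -[X in X - _]scale1r -scalerBl enormZ ?subr_ge0//.
  by apply: ler_wpM2l; rewrite ?subr_ge0//; exact: le_trans fx fr.
have h2 : enorm (x - t *: f (pif' x)) <= 3 * r.
  apply: le_trans (ler_enormBD _ _) _; rewrite enormZ//.
  have := le_trans (enorm_le_supnorm f (pif' x) cf) fr.
  have := enorm_ge0 (f (pif' x)); set a := enorm (f _) => a0 ar; nra.
have := proj_dist_le _ xr; move: h1 h2; have := enorm_ge0 (x - t *: f (pif' x)).
have := enorm_ge0 (x - f (pif x)); have := enorm_ge0 x.
set a := enorm (x - t *: _); set b := enorm (x - f _) => x0 b0 a0 h1 h2 h3.
have r0 : 0 <= r by lra.
have [ab|ab] := leP a b.
  have : a ^+ 2 <= b ^+ 2 by rewrite ler_pXn2r.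
  have : 0 <= 12 * r ^+ 2 * (1 - t) by rewrite !mulr_ge0 ?sqr_ge0// subr_ge0.
  lra.
have -> : a ^+ 2 = b ^+ 2 + (a - b) * (a + b) by ring.
have -> : 12 * r ^+ 2 * (1 - t) = (1 - t) * (2 * r) * (6 * r) by ring.
by rewrite lerD2l ler_pM//; lra.
Qed.

End one_map.

End projection_distance.

(** * Uniform approximation of integrals by averages *)

Section cells.
Context {R : realType} {n : nat}.

(** The cells come from a finite cover by balls, made disjoint. *)
Lemma compact_cells (K : set 'rV[R]_n) (h : R) : compact K -> 0 < h ->
  exists (k : nat) (a : nat -> 'rV[R]_n) (A : nat -> set (borel 'rV[R]_n)),
  [/\ forall j, measurable (A j), trivIset [set: nat] A,
      forall x, K x -> exists2 j, (j < k)%N & A j x,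
      forall j, (j < k)%N -> K (a j) &
      forall j x, A j x -> enorm ((x : 'rV[R]_n) - a j) < h].
Proof.
rewrite compact_cover => cK h0.
have [||D DK KD] := cK _ K (fun x => [set y | enorm (y - x) < h]).
- by move=> x _; exact: open_enorm_ball.
- by move=> x Kx; exists x => //=; rewrite subrr enorm0.
pose a j := nth 0 (enum_fset D) j.
pose B j : set (borel 'rV[R]_n) := [set y | enorm (y - a j) < h].
exists (size (enum_fset D)), a, (seqDU B); split.
- move=> j; apply: measurableD; first by apply: borel_open; exact: open_enorm_ball.
  by apply: bigsetU_measurable => i _; apply: borel_open; exact: open_enorm_ball.
- exact: trivIset_seqDU.
- move=> x /KD[y /= yD yx].
  have ys : (index y (enum_fset D) < size (enum_fset D))%N by rewrite index_mem.
  have Bx : B (index y (enum_fset D)) x by rewrite /B/= /a nth_index.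
  have : (\big[setU/set0]_(i < size (enum_fset D)) B i) x.
    by rewrite -bigcup_mkord; exists (index y (enum_fset D)).
  rewrite bigsetU_seqDU -bigcup_mkord => -[j /= js jx].
  by exists j.
- by move=> j js; have := mem_nth 0 js => /DK; rewrite inE.
- by move=> j x [].
Qed.

Section quadrature.
Context (K : set 'rV[R]_n) (h L : R) (k : nat) (a : nat -> 'rV[R]_n).
Context (A : nat -> set (borel 'rV[R]_n)).
Hypotheses (h0 : 0 <= h) (L0 : 0 <= L).
Hypothesis mA : forall j, measurable (A j).
Hypothesis tA : trivIset [set: nat] A.
Hypothesis KA : forall x, K x -> exists2 j, (j < k)%N & A j x.
Hypothesis aK : forall j, (j < k)%N -> K (a j).
Hypothesis Ah : forall j x, A j x -> enorm ((x : 'rV[R]_n) - a j) < h.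
Context (phi : 'rV[R]_n -> R).
Hypothesis phi_lip :
  forall x y, K x -> K y -> phi x <= phi y + L * enorm (x - y).

Let s (x : borel 'rV[R]_n) : R := \sum_(j < k) phi (a j) * \1_(A j) x.

Lemma cell_approx x : K x -> `|phi x - s x| <= L * h.
Proof.
move=> Kx; have [j jk jx] := KA _ Kx.
have -> : s x = phi (a j).
  rewrite /s (bigD1 (Ordinal jk))//= indicE mem_set// mulr1 big1 ?addr0// => i ij.
  rewrite indicE memNset ?mulr0// => ix; move/eqP: ij; apply.
  by apply/val_inj/tA => //=; exists x.
have Lh : L * enorm (x - a j) <= L * h by apply: ler_wpM2l => //; exact/ltW/Ah.
have := phi_lip _ _ Kx (aK _ jk); have := phi_lip _ _ (aK _ jk) Kx.
by rewrite enormB ler_norml; lra.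
Qed.

Lemma average_cell_approx N (x : nat -> 'rV[R]_n) : (0 < N)%N ->
  (forall i, (i < N)%N -> K (x i)) ->
  `|N%:R^-1 * (\sum_(i < N) phi (x i)) -
    \sum_(j < k) phi (a j) * (N%:R^-1 * \sum_(i < N) \1_(A j) (x i))| <= L * h.
Proof.
move=> N0 xK; have n0 : 0 < N%:R :> R by rewrite ltr0n.
have -> : \sum_(j < k) phi (a j) * (N%:R^-1 * \sum_(i < N) \1_(A j) (x i)) =
    N%:R^-1 * \sum_(i < N) s (x i).
  rewrite /s exchange_big/= mulr_sumr; apply: eq_bigr => j _.
  by rewrite mulrCA mulr_sumr.
rewrite -mulrBr -sumrB normrM gtr0_norm ?invr_gt0// ler_pdivrMl//.
apply: le_trans (ler_norm_sum _ _ _) _.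
apply: le_trans (ler_sum _ _ : _ <= \sum_(i < N) L * h) _.
  by move=> i _; apply: cell_approx; exact: xK.
by rewrite sumr_const card_ord mulr_natl.
Qed.

Context (P : probability (borel 'rV[R]_n) R).
Hypotheses (cK : closed K) (PK : P (~` K) = 0%E).
Hypothesis phi_ge0 : forall x, 0 <= phi x.
Hypothesis mphi : measurable_fun [set: borel 'rV[R]_n]
  (phi : borel 'rV[R]_n -> R).

Let ms : measurable_fun [set: borel 'rV[R]_n] s.
Proof.
by apply: measurable_sum => j; apply: measurable_funM.
Qed.

Let s_ge0 x : 0 <= s x.
Proof. by apply: sumr_ge0 => j _; rewrite mulr_ge0. Qed.

Let int_s : (\int[P]_x (s x)%:E = (\sum_(j < k) phi (a j) * fine (P (A j)))%:E)%E.
Proof.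
under eq_integral do rewrite /s -sumEFin.
rewrite ge0_integral_sum; [|by []| |]; last 2 first.
- by move=> j; apply/measurable_EFinP; apply: measurable_funM.
- by move=> j x _; rewrite lee_fin mulr_ge0.
rewrite -sumEFin; apply: eq_bigr => j _.
under eq_integral do rewrite EFinM.
rewrite ge0_integralZl_EFin//; last first.
  by apply/measurable_EFinP; exact: measurable_indic.
by rewrite integral_indic// setIT EFinM fineK// fin_num_measure.
Qed.

Let ae_le (u v : borel 'rV[R]_n -> R) c :
  measurable_fun [set: borel 'rV[R]_n] u -> measurable_fun [set: borel 'rV[R]_n] v ->
  (forall x, 0 <= u x) -> (forall x, 0 <= v x) -> 0 <= c ->
  (forall x, K x -> u x <= v x + c) ->
  (\int[P]_x (u x)%:E <= \int[P]_x (v x)%:E + c%:E)%E.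
Proof.
move=> mu mv u0 v0 c0 uv.
have -> : c%:E = (\int[P]_x c%:E)%E.
  by rewrite integral_cst// [X in (_ * X)%E](@probability_setT _ _ _ P) mule1.
rewrite -ge0_integralD//; last first.
- by apply/measurable_EFinP.
- by move=> x _; rewrite lee_fin.
apply: ae_ge0_le_integral => //.
- by move=> x _; rewrite lee_fin.
- exact/measurable_EFinP.
- by move=> x _; rewrite -EFinD lee_fin addr_ge0.
- by apply/measurable_EFinP; exact: measurable_funD.
exists (~` K); split=> //.
  by apply: borel_open; exact: closed_openC.
move=> x /= /not_implyP[_ h1] Kx; apply: h1.
by rewrite -EFinD lee_fin uv.
Qed.

Lemma integral_cell_approx : exists2 v : R,
  (\int[P]_x (phi x)%:E = v%:E)%E &
  `|v - \sum_(j < k) phi (a j) * fine (P (A j))| <= L * h.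
Proof.
have Lh0 : 0 <= L * h by rewrite mulr_ge0.
have h1 := ae_le _ _ _ mphi ms phi_ge0 s_ge0 Lh0.
have h2 := ae_le _ _ _ ms mphi s_ge0 phi_ge0 Lh0.
move: h1 h2; rewrite int_s.
set S := \sum_(j < k) _ => h1 h2.
have {}h1 : (\int[P]_x (phi x)%:E <= S%:E + (L * h)%:E)%E.
  by apply: h1 => x /cell_approx; rewrite ler_norml; lra.
have {}h2 : (S%:E <= \int[P]_x (phi x)%:E + (L * h)%:E)%E.
  by apply: h2 => x /cell_approx; rewrite ler_norml; lra.
have i0 : (0 <= \int[P]_x (phi x)%:E)%E.
  by apply: integral_ge0 => x _; rewrite lee_fin.
move: h1 h2 i0; case: (\int[P]_x _)%E => [v|//|//].
rewrite -!EFinD !lee_fin => h1 h2 _; exists v => //.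
by rewrite ler_norml; lra.
Qed.

End quadrature.

(** One finite family of cells serves all functions with the same Lipschitz
constant and bound, so that a law of large numbers for finitely many events
gives uniform convergence over this class of functions. *)
Lemma uniform_average_approx (K : set 'rV[R]_n)
    (P : probability (borel 'rV[R]_n) R) (L B e : R) :
  compact K -> closed K -> P (~` K) = 0%E -> 0 <= L -> 0 <= B -> 0 < e ->
  exists (k : nat) (A : nat -> set (borel 'rV[R]_n)) (delta : R),
  [/\ 0 < delta, forall j, measurable (A j) &
  forall (phi : 'rV[R]_n -> R),
    measurable_fun [set: borel 'rV[R]_n] (phi : borel 'rV[R]_n -> R) ->
    (forall x, 0 <= phi x) -> (forall x, K x -> phi x <= B) ->
    (forall x y, K x -> K y -> phi x <= phi y + L * enorm (x - y)) ->
    exists2 v : R, (\int[P]_x (phi x)%:E = v%:E)%E &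
    forall N (x : nat -> 'rV[R]_n), (0 < N)%N ->
      (forall i, (i < N)%N -> K (x i)) ->
      (forall j, (j < k)%N ->
        `|N%:R^-1 * (\sum_(i < N) \1_(A j) (x i)) - fine (P (A j))| < delta) ->
      `|N%:R^-1 * (\sum_(i < N) phi (x i)) - v| <= e].
Proof.
move=> cK clK PK L0 B0 e0.
(* Cells of diameter about h cost L h <= e / 4 for the average and for the
   integral; the frequencies then cost at most k B delta <= e / 2. *)
pose h := e / (4 * (L + 1)).
have L1 : 0 < 4 * (L + 1) by lra.
have h0 : 0 < h by rewrite divr_gt0.
have Lh : L * h <= e / 4.
  rewrite /h mulrA ler_pdivrMr// (_ : e / 4 * _ = (L + 1) * e); last by field.
  by rewrite mulrDl mul1r lerDl ltW.
have [k [a [A [mA tA KA aK Ah]]]] := compact_cells K h cK h0.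
pose c : R := (k.+1%:R * (B + 1)).
have c0 : 0 < c by rewrite mulr_gt0//; lra.
exists k, A, (e / (2 * c)); split=> //.
  by rewrite divr_gt0// mulr_gt0.
move=> phi mphi phi0 phiB philip.
have [v Iv vS] := integral_cell_approx K h L k a A (ltW h0) L0 mA tA KA aK Ah
  phi philip P clK PK phi0 mphi.
exists v => // N x N0 xK xA.
have xS := average_cell_approx K h L k a A L0 tA KA aK Ah phi philip N x N0 xK.
set S := \sum_(j < k) _ in vS; set S' := \sum_(j < k) _ in xS.
have SS : `|S' - S| <= e / 2.
  rewrite /S' /S -sumrB; apply: le_trans (ler_norm_sum _ _ _) _.
  apply: le_trans (ler_sum _ _ : _ <= \sum_(j < k) B * (e / (2 * c))) _.
    move=> j _; rewrite -mulrBr normrM ler_pM//; last exact/ltW/xA.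
    by rewrite ger0_norm// phiB//; exact: aK.
  rewrite sumr_const card_ord -[leLHS]mulr_natl.
  have -> : e / 2 = (k.+1%:R * (B + 1)) * (e / (2 * c)).
    by rewrite -/c; field; rewrite gt_eqF.
  rewrite mulrA ler_wpM2r//; first by rewrite ltW// divr_gt0// mulr_gt0.
  by rewrite ler_pM// ?ler_nat//; lra.
move: vS xS SS; rewrite !ler_norml; lra.
Qed.

End cells.

(** * Frequencies of events along an i.i.d. sample *)

Section iid_sample.
Context {R : realType} {D : nat} {dO : measure_display}.
Context {Omega : measurableType dO} (Pr : probability Omega R).
Context (P : probability (borel 'rV[R]_D) R) (X : nat -> Omega -> 'rV[R]_D).
Hypothesis hX : iid Pr P X.

Lemma iid_pair (A : set (borel 'rV[R]_D)) i j : measurable A -> i != j ->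
  Pr (X i @^-1` A `&` X j @^-1` A) = (fine (P A) ^+ 2)%:E.
Proof.
move=> mA ij; have [_ XP /(_ [fset i; j]%fset (fun=> A) (fun=> mA))] := hX.
rewrite big_fsetU1/=; last by rewrite inE.
rewrite big_seq_fset1 !XP// => XA.
have -> : X i @^-1` A `&` X j @^-1` A =
    \bigcap_(l in [set` [fset i; j]%fset]) X l @^-1` A.
  apply/seteqP; split=> [w [wi wj] l /=|w wA].
    by rewrite !inE => /orP[/eqP->|/eqP->].
  by split; apply: wA; rewrite /= !inE eqxx ?orbT.
by rewrite XA -[P A]fineK ?fin_num_measure// -EFinM.
Qed.

(** A union bound over the k events gives the rate O(1/N); leaving K adds nothing
to it, since countably many null events form a null event. *)
Lemma iid_bad_events (K : set (borel 'rV[R]_D)) (k : nat)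
    (A : nat -> set (borel 'rV[R]_D)) (delta : R) :
  measurable K -> P (~` K) = 0%E -> (forall j, measurable (A j)) -> 0 < delta ->
  exists (C : R) (Bd : nat -> set Omega),
  [/\ forall N, measurable (Bd N),
      forall N, (0 < N)%N -> (Pr (Bd N) <= (C * N%:R^-1)%:E)%E &
      forall N w, ~ Bd N w -> (forall i, K (X i w)) /\
        forall j, (j < k)%N ->
          `|N%:R^-1 * (\sum_(i < N) \1_(A j) (X i w)) - fine (P (A j))| < delta].
Proof.
move=> mK PK mA delta0; have [mX XP _] := hX.
have mXi i (B : set (borel 'rV[R]_D)) : measurable B -> measurable (X i @^-1` B).
  by move=> mB; rewrite -[X in measurable X]setTI; exact: mX.
pose Null := \bigcup_i X i @^-1` (~` K).
have mKC : measurable (~` K) by exact: measurableC.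
have mNull : measurable Null by apply: bigcup_measurable => i _; exact: mXi.
have Null0 : Pr Null = 0%E.
  apply: (proj1 (@negligibleP _ _ _ Pr _ mNull)).
  apply: negligible_bigcup => i.
  apply: (proj2 (@negligibleP _ _ _ Pr _ (mXi i _ mKC))).
  by rewrite -PK; exact: XP.
pose p j := fine (P (A j)).
pose Dev N j := [set w | delta <=
  `|N%:R^-1 * (\sum_(i < N) \1_(X i @^-1` A j) w) - p j|].
have mDev N j : measurable (Dev N j).
  exact: (measurable_deviation (fun i => X i @^-1` A j) (p j)
    (fun i => mXi i _ (mA j)) N delta).
have PDev N j : (0 < N)%N ->
    (Pr (Dev N j) <= ((p j - p j ^+ 2) / delta ^+ 2 * N%:R^-1)%:E)%E.
  have Ep i : Pr (X i @^-1` A j) = (p j)%:E.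
    by rewrite /p fineK ?fin_num_measure//; exact: XP.
  have Epp i i' : i != i' ->
      Pr (X i @^-1` A j `&` X i' @^-1` A j) = (p j ^+ 2)%:E.
    by move=> ii'; exact: iid_pair.
  have mE i : measurable (X i @^-1` A j) by exact: mXi.
  by move=> N0; exact: (weak_law_events Pr _ _ mE Ep Epp N delta N0 delta0).
exists (\sum_(j < k) (p j - p j ^+ 2) / delta ^+ 2),
  (fun N => Null `|` \big[setU/set0]_(j < k) Dev N j); split.
- by move=> N; apply: measurableU => //; exact: bigsetU_measurable.
- move=> N N0; set S := \big[setU/set0]_(j < k) _.
  have mS : measurable S by exact: bigsetU_measurable.
  have : (Pr (Null `|` S) <= Pr Null + Pr S)%E by exact: measureU2.
  move=> /le_trans; apply.
  rewrite Null0 add0e mulr_suml -sumEFin.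
  have : (Pr S <= \sum_(j < k) Pr (Dev N j))%E by exact: content_subadditive.
  by move=> /le_trans; apply; apply: lee_sum => j _; exact: PDev.
- move=> N w /not_orP[wN wD]; split=> [i|j jk].
    by apply: contrapT => wi; apply: wN; exists i.
  rewrite ltNge; apply/negP => dj; apply: wD; by rewrite -bigcup_mkord; exists j.
Qed.

End iid_sample.

(** * Radii of the support and of the sample *)

Section radii.
Context {R : realType} {n : nat}.

Lemma enorm_le_rad0 (Q : set 'rV[R]_n -> \bar R) x :
  compact (msupport Q) -> msupport Q x -> enorm x <= rad0 Q.
Proof.
move=> cQ Qx; apply: ub_le_sup; last by exists x.
have : compact (@enorm R n @` msupport Q).
  apply: continuous_compact => //; apply: continuous_subspaceT.
  exact: continuous_enorm.
move=> /compact_bounded[B [_ HB]]; exists (B + 1) => _ [q Qq <-].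
apply: le_trans (ler_norm _) _; apply: (HB (B + 1)); first by rewrite ltrDl.
by exists q.
Qed.

Section sample_radius.
Context (Q : set 'rV[R]_n -> \bar R) (N : nat) (x : nat -> 'rV[R]_n).
Hypothesis cQ : compact (msupport Q).
Hypothesis xQ : forall i, (i < N)%N -> msupport Q (x i).

Lemma msupport_empirical_sub :
  msupport (empirical_measure N x) `<=` msupport Q.
Proof.
move=> y Ny; apply: contrapT => Qy.
have := Ny (~` msupport Q) (closed_openC (closed_msupport Q)) Qy.
rewrite /empirical_measure big1 ?mule0 ?ltxx// => i _.
by rewrite diracE memNset//= => /(_ (xQ _ (ltn_ord i))).
Qed.

Lemma msupport_empirical i : (i < N)%N ->
  msupport (empirical_measure N x) (x i).
Proof.
move=> iN U oU Ux; rewrite /empirical_measure.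
have N0 : 0 < N%:R :> R by rewrite ltr0n (leq_ltn_trans _ iN).
rewrite mule_gt0 ?lte_fin ?invr_gt0// (bigD1 (Ordinal iN))//=.
rewrite diracE mem_set//=; apply: (@lt_le_trans _ _ 1%E); first exact: lte01.
by apply: leeDl; apply: sume_ge0.
Qed.

Let has_ubound_empirical :
  has_ubound [set enorm y | y in msupport (empirical_measure N x)].
Proof.
exists (rad0 Q) => _ [y /msupport_empirical_sub Qy <-].
exact: enorm_le_rad0.
Qed.

Lemma enorm_le_rad0_empirical i : (i < N)%N ->
  enorm (x i) <= rad0 (empirical_measure N x).
Proof.
move=> iN; apply: ub_le_sup => //.
by exists (x i) => //; exact: msupport_empirical.
Qed.

Lemma rad0_empirical_le : (0 < N)%N -> rad0 (empirical_measure N x) <= rad0 Q.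
Proof.
move=> N0; apply: ge_sup => [|_ [y /msupport_empirical_sub Qy <-]].
  by exists (enorm (x 0%N)), (x 0%N) => //; exact: msupport_empirical.
exact: enorm_le_rad0.
Qed.

End sample_radius.

End radii.

(** * Consistency *)

(** The measurable events Bd N stand in for the possibly non-measurable sets
where Z N is large. *)
Lemma cvg0_outer_probability_bound {R : realType} {dO : measure_display}
    {Omega : measurableType dO} (Pr : probability Omega R)
    (Z : nat -> Omega -> R) :
  (forall e : R, 0 < e -> exists (C : R) (Bd : nat -> set Omega),
    [/\ forall N, measurable (Bd N),
        forall N, (0 < N)%N -> (Pr (Bd N) <= (C * N%:R^-1)%:E)%E &
        forall N w, (0 < N)%N -> ~ Bd N w -> `|Z N w| <= e]) ->
  cvg0_outer_probability Pr Z.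
Proof.
move=> ZB e e0; have [C [Bd [mBd PBd ZBd]]] := ZB e e0.
rewrite -cvg_shiftS /=.
apply: (@squeeze_cvge _ _ _ _ (cst 0%E) _ (fun N => (C * N.+1%:R^-1)%:E) _ 0%E).
- apply: nearW => N; rewrite /outer_probability; apply/andP; split.
    by apply: le_ereal_inf_tmp => _ [B [mB _] <-]; exact: measure_ge0.
  apply: le_trans (PBd N.+1 _) => //; apply: ereal_inf_lbound.
  exists (Bd N.+1) => //; split=> // w /=; rewrite ltNge => /negP Zw.
  by apply: contrapT => wB; apply: Zw; exact: ZBd.
- exact: cvg_cst.
- apply: cvg_EFin; first exact: nearW.
  rewrite -(mulr0 C); apply: cvgM; first exact: cvg_cst.
  exact: cvg_harmonic.
Qed.

Lemma gap_below_ereal_inf {R : realType} (a : R) (s : \bar R) :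
  (a%:E < s)%E -> exists2 e : R, 0 < e & ((a + e)%:E <= s)%E.
Proof.
case: s => [b|_|//]; last by exists 1; rewrite ?leey.
by rewrite lte_fin => ab; exists (b - a); rewrite ?subr_gt0// addrC subrK.
Qed.

(** The final comparison: N, s and t refer to the empirical minimizer, to f* and
to its contraction; v, a and E are the expectation, the average and the weighted
energy.  The terms vs + Es and vN + EN differ by at most 3 gap / 4. *)
Lemma empirical_gap_absurd {R : realType} (gap b vs vN aN at' as' EN Et Es : R) :
  0 < gap -> b <= gap / 4 -> vs + Es + gap <= vN + EN ->
  `|as' - vs| <= gap / 4 -> `|aN - vN| <= gap / 4 ->
  aN + EN <= at' + Et -> at' <= as' + b -> Et <= Es -> False.
Proof.
move=> gap0 hb h1; rewrite !ler_norml => /andP[h2 h3] /andP[h4 h5] h6 h7 h8.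
lra.
Qed.

(** A map enters the risk only through its squared distance function, and these
functions are bounded and equi-Lipschitz on the support of P. *)
Lemma uniform_risk_approx {R : realType} {d D : nat} {M : smoothManifold R d}
    (P : probability (borel 'rV[R]_D) R) (e : R) :
  compact [set: M] -> compact (msupport P) -> 0 <= rad0 P -> 0 < e ->
  exists (k : nat) (A : nat -> set (borel 'rV[R]_D)) (delta : R),
  [/\ 0 < delta, forall j, measurable (A j) &
  forall (f : M -> 'rV[R]_D) (pif : 'rV[R]_D -> M),
    continuous f -> projection_index f pif -> supnorm f <= 2 * rad0 P ->
    exists2 v : R, (\int[P]_x (enorm ((x : 'rV[R]_D) - f (pif x)) ^+ 2)%:E = v%:E)%E &
    forall N (x : nat -> 'rV[R]_D), (0 < N)%N ->
      (forall i, (i < N)%N -> msupport P (x i)) ->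
      (forall j, (j < k)%N ->
        `|N%:R^-1 * (\sum_(i < N) \1_(A j) (x i)) - fine (P (A j))| < delta) ->
      `|N%:R^-1 * (\sum_(i < N) enorm (x i - f (pif (x i))) ^+ 2) - v| <= e].
Proof.
move=> cM cP r0 e0; have L0 : 0 <= 6 * rad0 P by rewrite mulr_ge0.
have Kr x : msupport P x -> enorm x <= rad0 P by exact: enorm_le_rad0.
have [k [A [delta [delta0 mA H]]]] := uniform_average_approx _ P _ _ e cP
  (closed_msupport P) (msupport_full P) L0 (sqr_ge0 (3 * rad0 P)) e0.
exists k, A, delta; split=> // f pif cf fP fr.
apply: (H (fun x => enorm (x - f (pif x)) ^+ 2)).
- exact: measurable_sq_proj_dist.
- by move=> x; exact: sqr_ge0.
- move=> x /Kr xr; rewrite ler_pXn2r ?nnegrE ?enorm_ge0 ?mulr_ge0//.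
  exact: (proj_dist_le cM f pif cf _ fr).
- by move=> x y /Kr xr /Kr yr; exact: (sq_proj_dist_lip cM f pif cf fP _ fr).
Qed.

Theorem theorem3p4 (R : realType) (d D : nat) (hd : (d < minn 4 D)%N)
    (M : smoothManifold R d) (g : riemannianMetric M)
    (hcompact : compact [set: M]) (hconnected : connected [set: M])
    (horientable : orientable M)
    (vol : {measure set (borel M) -> \bar R}) (hvol : riemannian_volume g vol)
    (P : probability (borel 'rV[R]_D) R) (hP : compact (msupport P))
    (lambda : R) (hlambda : 0 < lambda)
    (pi : (M -> 'rV[R]_D) -> 'rV[R]_D -> M)
    (hpi : forall f : M -> 'rV[R]_D, continuous f -> projection_index f (pi f))
    (dO : measure_display) (Omega : measurableType dO)
    (Pr : probability Omega R)
    (X : nat -> Omega -> 'rV[R]_D) (hX : iid Pr P X)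
    (fstar : M -> 'rV[R]_D)
    (hfstar : is_minimizer (loss g vol P lambda pi) (feasible g vol P) fstar)
    (hunique : forall G : set (M -> 'rV[R]_D), sup_open G -> G fstar ->
       (loss g vol P lambda pi fstar <
        ereal_inf [set loss g vol P lambda pi f |
                     f in feasible g vol P `\` G])%E)
    (fN : nat -> Omega -> M -> 'rV[R]_D)
    (hfN : forall (N : nat) (w : Omega), (0 < N)%N ->
       is_minimizer (empirical_loss g vol N (fun i => X i w) lambda pi)
         (feasible g vol (empirical_measure N (fun i => X i w))) (fN N w)) :
  cvg0_outer_probability Pr
    (fun N w => supnorm (fun p => fN N w p - fstar p)).
Proof.
apply: cvg0_outer_probability_bound => e e0.
pose K : set 'rV[R]_D := msupport P; pose r := rad0 P.
have clK : closed K by exact: closed_msupport.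
have mK : measurable (K : set (borel 'rV[R]_D)) by exact: borel_closed.
have PK : P (~` K) = 0%E by exact: (msupport_full P).
have Kr x : K x -> enorm x <= r by exact: enorm_le_rad0.
have [[[cfstar _] sfstar] _] := hfstar.
have cB (u v : M -> 'rV[R]_D) : continuous u -> continuous v ->
    continuous (fun p => u p - v p).
  by move=> cu cv p; apply: cvgB; [exact: cu|exact: cv].
have cfN N w : (0 < N)%N -> continuous (fN N w).
  by move=> /(hfN _ w)[[[]]].
have fNr N w : (0 < N)%N -> (forall i, K (X i w)) -> feasible g vol P (fN N w).
  move=> N0 XK; have [[HfN sfN] _] := hfN N w N0; split=> //.
  apply: le_trans sfN _; rewrite ler_pM2l//.
  by apply: rad0_empirical_le => // i _; exact: XK.
have ZE N w : (0 < N)%N -> `|supnorm (fun p => fN N w p - fstar p)| =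
    supnorm (fun p => fN N w p - fstar p).
  by move=> N0; rewrite ger0_norm// supnorm_ge0//; apply: cB => //; exact: cfN.
(* If P is the Dirac mass at 0, all feasible maps vanish. *)
have [r0|r0] := leP r 0.
  have [C [Bd [mBd PBd HBd]]] := @iid_bad_events R D dO Omega Pr P X hX K 0
    (fun=> set0) 1 mK PK (fun=> measurable0) ltr01.
  exists C, Bd; split=> // N w N0 /HBd[XK _]; rewrite ZE//.
  have [_ sfN] := fNr N w N0 XK.
  apply: (supnorm_le _ _) => p; apply: le_trans (ler_enormBD _ _) _.
  have h1 := le_trans (enorm_le_supnorm hcompact (fN N w) p (cfN N w N0)) sfN.
  have h2 := le_trans (enorm_le_supnorm hcompact fstar p cfstar) sfstar.
  apply: le_trans (lerD h1 h2) _; rewrite -/r; lra.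
pose sq f x := enorm (x - f (pi f x)) ^+ 2.
pose G : set (M -> 'rV[R]_D) :=
  [set h : M -> 'rV[R]_D |
     continuous h /\ supnorm (fun p => h p - fstar p) < e].
have oG : sup_open G by exact: sup_open_ball.
have Gfstar : G fstar.
  split=> //; apply: le_lt_trans e0; apply: supnorm_le => p.
  by rewrite subrr enorm0.
have gapG := hunique G oG Gfstar.
pose E (f : M -> 'rV[R]_D) := hessian_energy g vol f.
(* Finiteness of the risk; the accuracy is fixed afterwards, from the gap. *)
have [vs Ivs] : exists v : R, (\int[P]_x (sq fstar x)%:E = v%:E)%E.
  have [k [A [delta [_ _ H]]]] :=
    uniform_risk_approx P 1 hcompact hP (ltW r0) ltr01.
  by have [v Iv _] := H fstar (pi fstar) cfstar (hpi _ cfstar) sfstar; exists v.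
have lossE f v : (\int[P]_x (sq f x)%:E = v%:E)%E ->
    loss g vol P lambda pi f = (v + lambda * E f)%:E.
  by rewrite /loss /sq => ->.
rewrite (lossE _ _ Ivs) in gapG.
have [gap gap0 gapP] := gap_below_ereal_inf _ _ gapG.
(* The loss of scaling by t is at most c (1 - t) <= c eta <= gap / 4. *)
pose c := 12 * r ^+ 2.
have c0 : 0 < c by rewrite mulr_gt0// exprn_gt0.
pose eta := gap / (4 * (c + gap)).
have eta0 : 0 < eta by rewrite divr_gt0// mulr_gt0// addr_gt0.
have eta1 : eta < 1 by rewrite ltr_pdivrMr; lra.
have ceta : c * eta <= gap / 4.
  rewrite /eta mulrA ler_pdivrMr; last by lra.
  by rewrite (_ : gap / 4 * _ = c * gap + gap ^+ 2); [rewrite lerDl sqr_ge0|field].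
have kap0 : 0 < gap / 4 by lra.
have [k [A [delta [delta0 mA H]]]] :=
  uniform_risk_approx P (gap / 4) hcompact hP (ltW r0) kap0.
(* A sample point in U makes the radius of the sample nearly r. *)
pose U : set (borel 'rV[R]_D) := [set y : 'rV[R]_D | (1 - eta) * r < enorm y].
have oU : open (U : set 'rV[R]_D).
  by apply: (open_comp (D := [set z | (1 - eta) * r < z])) => [y _|];
    [exact: continuous_enorm|exact: open_gt].
have mU : measurable U by exact: borel_open.
have PU : 0 < fine (P U).
  have [_ [y Ky <-] yr] : exists2 z, [set enorm x | x in K] z & (1 - eta) * r < z.
    apply: sup_gt; last by rewrite -/(rad0 P) -/r mulrBl mul1r gtrBl mulr_gt0.
    apply/set0P/eqP => K0; move: r0.
    by rewrite /r /rad0 -/K K0 sup0 ltxx.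
  by rewrite fine_gt0// (Ky _ oU yr)/= ltey_eq fin_num_measure.
pose A' j := if (j < k)%N then A j else U.
have mA' j : measurable (A' j) by rewrite /A'; case: ifP.
have delta'0 : 0 < Num.min delta (fine (P U)) by rewrite lt_min delta0.
have [C [Bd [mBd PBd HBd]]] := iid_bad_events Pr P X hX K k.+1 A' _ mK PK mA' delta'0.
exists C, Bd; split=> // N w N0 /HBd[XK XA]; rewrite ZE// leNgt; apply/negP => Ze.
have fNF := fNr N w N0 XK; have [_ sfN] := fNF.
have cN := cfN N w N0; have n0 : 0 < N%:R :> R by rewrite ltr0n.
have XKN i : (i < N)%N -> msupport P (X i w) by move=> _; exact: XK.
have XAN j : (j < k)%N ->
    `|N%:R^-1 * (\sum_(i < N) \1_(A j) (X i w)) - fine (P (A j))| < delta.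
  move=> jk; have := XA j (ltnW jk); rewrite /A' jk => /lt_le_trans; apply.
  by rewrite ge_min lexx.
have [i iN XU] : exists2 i, (i < N)%N & U (X i w).
  apply: contrapT => XU; have := XA k (ltnSn k); rewrite /A' ltnn.
  rewrite big1 ?mulr0 ?sub0r ?normrN => [|j _]; last first.
    by rewrite indicE memNset// => Uj; apply: XU; exists j.
  by rewrite gtr0_norm// ltNge ge_min lexx orbT.
pose rN := rad0 (empirical_measure N (fun i => X i w)).
have rNr : rN <= r by exact: rad0_empirical_le.
have rNU : (1 - eta) * r < rN.
  by apply: lt_le_trans XU _; exact: (enorm_le_rad0_empirical P).
pose t := rN / r.
have t0 : 0 < t.
  rewrite divr_gt0// (le_lt_trans _ rNU)// mulr_ge0 ?(ltW r0)//.
  by rewrite subr_ge0 ltW.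
have t1 : t <= 1 by rewrite ler_pdivrMr// mul1r.
have teta : 1 - t <= eta.
  by rewrite lerBlDr -lerBlDl ler_pdivlMr// ltW.
(* The competitor of f_N: it satisfies the bound of the empirical class. *)
pose ft p := t *: fstar p.
have cft : continuous ft by move=> p; apply: cvgZr; exact: cfstar.
have Fft : feasible g vol (empirical_measure N (fun i => X i w)) ft.
  split; first by apply: H2_scale => //; case: hfstar => -[].
  apply: supnorm_le => p; rewrite enormZ ?(ltW t0)// -/rN.
  have -> : 2 * rN = t * (2 * r) by rewrite /t; field; rewrite gt_eqF.
  rewrite ler_pM2l//; apply: le_trans sfstar.
  exact: (enorm_le_supnorm hcompact).
have [_ /(_ ft Fft)] := hfN N w N0; rewrite /empirical_loss lee_fin.
have Eft : lambda * E ft <= lambda * E fstar.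
  exact: ler_wpM2l (ltW hlambda) _ _ (hessian_energy_contract g vol fstar t t0 t1).
have avg_ft : N%:R^-1 * (\sum_(i < N) sq ft (X i w)) <=
    N%:R^-1 * (\sum_(i < N) sq fstar (X i w)) + c * eta.
  have -> : c * eta = N%:R^-1 * (\sum_(i < N) c * eta).
    by rewrite sumr_const card_ord -(mulr_natl (c * eta)) mulKf// gt_eqF.
  rewrite -mulrDr -big_split/= ler_pM2l ?invr_gt0//; apply: ler_sum => j _.
  apply: (@le_trans _ _ (sq fstar (X j w) + c * (1 - t))).
    exact: (sq_proj_dist_shrink hcompact fstar (pi fstar) cfstar r sfstar t
      (pi ft) (X j w) (ltW t0) t1 (hpi _ cft) (Kr _ (XK j))).
  by rewrite lerD2l ler_pM2l.
have [vN IvN vNP] := H (fN N w) (pi (fN N w)) cN (hpi _ cN) sfN.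
have [vs' Ivs' vsP] := H fstar (pi fstar) cfstar (hpi _ cfstar) sfstar.
have vsE : vs' = vs by apply: EFin_inj; rewrite -Ivs' -Ivs.
have := vNP N _ N0 XKN XAN; have := vsP N _ N0 XKN XAN; rewrite vsE.
have : ((vs + lambda * E fstar + gap)%:E <= (vN + lambda * E (fN N w))%:E)%E.
  apply: le_trans gapP _; rewrite -(lossE _ _ IvN); apply: ereal_inf_lbound.
  by exists (fN N w) => //; split=> // -[_]; rewrite ltNge (ltW Ze).
rewrite lee_fin -/(E (fN N w)) -/(E ft) => hgap hs hN hmin.
exact: (empirical_gap_absurd _ _ _ _ _ _ _ _ _ _ gap0 ceta hgap hs hN hmin avg_ft Eft).
Qed.
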